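(* In the setting and notation described in the context, let $(w,\boldsymbol\phi,p,u)$ be the solution of the continuous decoupled biharmonic problem and $(w_h,\boldsymbol\phi_h,p_h,u_h)\in V_h\times\boldsymbol X_h\times P_h\times V_h$ the solution of the discrete problem. Assume that $V_h$ and $\boldsymbol X_h$ are $H^1$ conforming, that the discrete spaces are consistent with respect to the continuous problem, and that the inf-sup condition $$\|q_h\|_0\lesssim\sup_{\boldsymbol\psi_h\in\boldsymbol X_h}\frac{(\operatorname{div}\boldsymbol\psi_h,q_h)}{|\boldsymbol\psi_h|_1}\qquad\forall\,q_h\in P_h$$ holds. Then $$\|w-w_h\|_1+\|\boldsymbol\phi-\boldsymbol\phi_h\|_1+\|p-p_h\|_0+\|u-u_h\|_1\lesssim\inf_{\chi_h\in V_h}\|w-\chi_h\|_1+\inf_{\boldsymbol\psi_h\in\boldsymbol X_h}\|\boldsymbol\phi-\boldsymbol\psi_h\|_1+\inf_{q_h\in P_h}\|p-q_h\|_0+\inf_{v_h\in V_h}\|u-v_h\|_1.$$ Moreover, if $$\|\boldsymbol\phi-\boldsymbol\phi_h\|_0\lesssim h^\delta\Big(\|\boldsymbol\phi-\boldsymbol\phi_h\|_1+\inf_{q_h\in P_h}\|p-q_h\|_0\Big),$$ then $$|P_h^{\mathrm{grad}}u-u_h|_1\lesssim h^\delta\Big(\inf_{\chi_h\in V_h}\|w-\chi_h\|_1+\inf_{\boldsymbol\psi_h\in\boldsymbol X_h}\|\boldsymbol\phi-\boldsymbol\psi_h\|_1+\inf_{q_h\in P_h}\|p-q_h\|_0\B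ig).$$
   Context: $\Omega\subset\mathbb R^2$ is a bounded Lipschitz domain, simply connected with connected boundary; $f\in L^2(\Omega)$; $V_h\subset H_0^1(\Omega)$, $\boldsymbol X_h\subset\boldsymbol H_0^1(\Omega;\mathbb R^2)$, $P_h\subset L_0^2(\Omega)$ ($L^2$ functions with zero mean) are finite element (finite-dimensional) spaces on meshes of size $h$; $\lesssim$ means $\le C\cdots$ with $C$ independent of $h$. $\delta\in(1/2,1]$ is a regularity constant depending on the shape of $\Omega$. $(\cdot,\cdot)$ is the $L^2$ inner product, $|\cdot|_1$ the $H^1$ seminorm, $\operatorname{curl}v=(\partial_2v,-\partial_1v)^{\intercal}$. Continuous problem: find $w,u\in H_0^1(\Omega)$, $\boldsymbol\phi\in\boldsymbol H_0^1(\Omega;\mathbb R^2)$, $p\in L_0^2(\Omega)$ with $(\operatorname{curl}w,\operatorname{curl}v)=(f,v)$ for all $v\in H_0^1(\Omega)$; $(\nabla\boldsymbol\phi,\nabla\boldsymbol\psi)+(\operatorname{div}\boldsymbol\psi,p)=(\operatorname{curl}w,\boldsymbol\psi)$ for all $\boldsymbol\psi\in\boldsymbol H_0^1(\Omega;\mathbb R^2)$; $(\operatorname{div}\boldsymbol\phi,q)=0$ for all $q\in L_0^2(\Omega)$; $(\operatorname{curl}u,\operatorname{curl}\chi)=(\boldsymbol\phi,\operatorname{curl}\chi)$ for all $\chi\in H_0^1(\Omega)$. Discrete problem: the same four equations with $H_0^1(\Omega),\boldsymbol H_0^1(\Omega;\mathbb R^2),L_0^2(\Omega)$ replaced by $V_h,\boldsymbol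 X_h,P_h$ (trial and test spaces) and unknowns $w_h,\boldsymbol\phi_h,p_h,u_h$. Consistency means that the continuous solution satisfies the discrete equations for all discrete test functions (automatic for these conforming spaces). $P_h^{\mathrm{grad}}$ is the $H^1$-orthogonal projection onto $V_h$: $(\nabla P_h^{\mathrm{grad}}u,\nabla\chi_h)=(\nabla u,\nabla\chi_h)$ for all $\chi_h\in V_h$. *)

(* Defs.v *)
From HB Require Import structures.
From mathcomp Require Import all_boot all_order all_algebra.
From mathcomp Require Import all_classical all_reals all_analysis.

Set Implicit Arguments.
Unset Strict Implicit.
Unset Printing Implicit Defensive.

Import Order.TTheory GRing.Theory Num.Theory.
Import numFieldNormedType.Exports.

Local Open Scope classical_set_scope.
Local Open Scope ring_scope.

Section Domains.
Context {R : realType}.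
Implicit Type Omega : set (R * R).

Definition boundary Omega : set (R * R) := closure Omega `\` interior Omega.

(* Near each boundary point there is an orthonormal frame, with axes (a, b) and
   (- b, a), in which Omega is the strict epigraph of a Lipschitz function. *)
Definition lipschitz_boundary Omega : Prop :=
  forall x0, boundary Omega x0 ->
    exists (a b r : R) (g : R -> R),
      [/\ a ^+ 2 + b ^+ 2 = 1, 0 < r, lipschitz g &
          forall x, ball x0 r x ->
            (Omega x <-> g (a * x.1 + b * x.2) < - b * x.1 + a * x.2)].

Definition bounded_lipschitz_domain Omega : Prop :=
  [/\ Omega !=set0, open Omega, connected Omega, bounded_set Omega &
      lipschitz_boundary Omega].

(* Omega being open and connected, hence path connected, it remains to say that
   every loop is null-homotopic relative to its base point.  In [H (s, t)], s is
   the homotopy parameter and t runs along the loop. *)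
Definition simply_connected Omega : Prop :=
  forall c : R -> R * R,
    {within `[0, 1], continuous c} -> c @` `[0, 1] `<=` Omega -> c 0 = c 1 ->
    exists H : R * R -> R * R,
      [/\ {within (`[0, 1] `*` `[0, 1]), continuous H},
          H @` (`[0, 1] `*` `[0, 1]) `<=` Omega,
          forall t, t \in `[0, 1] -> H (0, t) = c t,
          forall t, t \in `[0, 1] -> H (1, t) = c 0 &
          forall s, s \in `[0, 1] -> H (s, 0) = c 0 /\ H (s, 1) = c 0].

End Domains.

(* Elements of the spaces below are represented by total functions on the plane;
   only their restrictions to Omega, up to almost everywhere equality, matter. *)

Section Spaces.
Context {R : realType}.
Variable Omega : set (R * R).

Definition leb2 := (@lebesgue_measure R \x @lebesgue_measure R)%E.

Definition L2 : set (R * R -> R) :=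
  [set f | (f \_ Omega : R * R -> R) \in Lfun leb2 2%:E].

Definition ip (f g : R * R -> R) : R := \int[leb2]_(x in Omega) (f x * g x).

Definition L20 : set (R * R -> R) :=
  [set q | L2 q /\ \int[leb2]_(x in Omega) q x = 0].

Definition e1 : R * R := (1, 0).
Definition e2 : R * R := (0, 1).

Fixpoint Ck (k : nat) (f : R * R -> R) : Prop :=
  continuous f /\
  if k is k'.+1 then
    forall e, e = e1 \/ e = e2 ->
      (forall x, derivable f x e) /\ Ck k' (fun x => 'D_e f x)
  else True.

Definition test_fun (z : R * R -> R) : Prop :=
  [/\ forall k, Ck k z, compact (closure [set x | z x != 0]) &
      closure [set x | z x != 0] `<=` Omega].

Definition is_weak_deriv (e : R * R) (v g : R * R -> R) : Prop :=
  L2 g /\ forall z, test_fun z -> ip v (fun x => 'D_e z x) = - ip g z.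

(* Unique almost everywhere in Omega when it exists; a junk value otherwise. *)
Definition wd (e : R * R) (v : R * R -> R) : R * R -> R :=
  xget (cst 0) [set g | is_weak_deriv e v g].

Definition H1 : set (R * R -> R) :=
  [set v | [/\ L2 v, exists g, is_weak_deriv e1 v g &
                     exists g, is_weak_deriv e2 v g]].

Definition grad (v : R * R -> R) : R * R -> R * R :=
  fun x => (wd e1 v x, wd e2 v x).

Definition curl (v : R * R -> R) : R * R -> R * R :=
  fun x => (wd e2 v x, - wd e1 v x).

Definition div (psi : R * R -> R * R) : R * R -> R :=
  fun x => wd e1 (fst \o psi) x + wd e2 (snd \o psi) x.

Definition ipv (F G : R * R -> R * R) : R :=
  ip (fst \o F) (fst \o G) + ip (snd \o F) (snd \o G).

Definition ip_grad (phi psi : R * R -> R * R) : R :=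
  ipv (grad (fst \o phi)) (grad (fst \o psi)) +
  ipv (grad (snd \o phi)) (grad (snd \o psi)).

Definition norm0 (v : R * R -> R) : R := Num.sqrt (ip v v).
Definition semi1 (v : R * R -> R) : R := Num.sqrt (ipv (grad v) (grad v)).
Definition norm1 (v : R * R -> R) : R :=
  Num.sqrt (norm0 v ^+ 2 + semi1 v ^+ 2).

Definition norm0v (psi : R * R -> R * R) : R := Num.sqrt (ipv psi psi).
Definition semi1v (psi : R * R -> R * R) : R := Num.sqrt (ip_grad psi psi).
Definition norm1v (psi : R * R -> R * R) : R :=
  Num.sqrt (norm0v psi ^+ 2 + semi1v psi ^+ 2).

Definition H10 : set (R * R -> R) :=
  [set v | H1 v /\
     forall eps, 0 < eps -> exists2 z, test_fun z & norm1 (v - z) < eps].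

Definition H10v : set (R * R -> R * R) :=
  [set psi | H10 (fst \o psi) /\ H10 (snd \o psi)].

(* Membership of the unknowns in trial spaces is not part of this predicate, so
   that consistency can be expressed with it. *)
Definition decoupled_equations
    (V : set (R * R -> R)) (X : set (R * R -> R * R)) (P : set (R * R -> R))
    (f w : R * R -> R) (phi : R * R -> R * R) (p u : R * R -> R) : Prop :=
  [/\ forall v, V v -> ipv (curl w) (curl v) = ip f v,
      forall psi, X psi -> ip_grad phi psi + ip (div psi) p = ipv (curl w) psi,
      forall q, P q -> ip (div phi) q = 0 &
      forall chi, V chi -> ipv (curl u) (curl chi) = ipv phi (curl chi)].

Definition decoupled_solution
    (V : set (R * R -> R)) (X : set (R * R -> R * R)) (P : set (R * R -> R))
    (f w : R * R -> R) (phi : R * R -> R * R) (p u : R * R -> R) : Prop :=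
  [/\ V w, X phi, P p, V u & decoupled_equations V X P f w phi p u].

Definition continuous_solution := decoupled_solution H10 H10v L20.

Definition finite_dim (E : lmodType R) (V : set E) : Prop :=
  exists (n : nat) (b : 'I_n -> E),
    V = [set v | exists c : 'I_n -> R, v = \sum_(i < n) c i *: b i].

Definition consistent
    (V : set (R * R -> R)) (X : set (R * R -> R * R)) (P : set (R * R -> R)) :=
  forall f w phi p u, L2 f ->
    continuous_solution f w phi p u -> decoupled_equations V X P f w phi p u.

(* By Cauchy-Schwarz the set of quotients is bounded above, so the real-valued
   sup is meaningful; it is 0 when the set is empty. *)
Definition inf_sup (C : R) (X : set (R * R -> R * R)) (P : set (R * R -> R)) :=
  forall q, P q ->
    norm0 q <= C * sup [set ip (div psi) q / semi1v psi |
                        psi in [set psi | X psi /\ semi1v psi != 0]].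

Definition is_grad_proj (V : set (R * R -> R)) (u Pu : R * R -> R) : Prop :=
  V Pu /\ forall chi, V chi -> ipv (grad Pu) (grad chi) = ipv (grad u) (grad chi).

Definition dist0 (P : set (R * R -> R)) (p : R * R -> R) : R :=
  inf [set norm0 (p - q) | q in P].
Definition dist1 (V : set (R * R -> R)) (v : R * R -> R) : R :=
  inf [set norm1 (v - chi) | chi in V].
Definition dist1v (X : set (R * R -> R * R)) (phi : R * R -> R * R) : R :=
  inf [set norm1v (phi - psi) | psi in X].

End Spaces.

(* Main.v *)
Require Import Defs.
From HB Require Import structures.
From mathcomp Require Import all_boot all_order all_algebra.
From mathcomp Require Import all_classical all_reals all_analysis.
From mathcomp Require Import measurable_realfun.
From mathcomp Require Import lra.

(** Why the estimates hold. Each of the three solves (Poisson, Stokes, Poisson)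
is a Galerkin approximation, and each sees the error of the previous one only
through its right-hand side.

The errors are governed by energy forms that are symmetric and nonnegative, but
not definite, since functions count only up to null sets inside the domain. The
record [semi_inner] isolates what is needed of them: Cauchy-Schwarz and the
triangle inequality. In this setting Galerkin orthogonality with a consistency
error gives [cea] and Brezzi's argument gives [saddle_estimate]. Applied to the
first equation, [cea] has no consistency error; in the Stokes problem the
residual is [curl (w - wh)] ([stokes_error]); in the last equation it is
[phi - phih] ([semi1_u_error]). The Poincare inequality turns energy seminorms
into the full norms and bounds the residuals. Taking infima over the discrete
functions gives the quasi-optimality. For the last assertion, the Galerkin
projection of [u] satisfies the discrete equation satisfied by [uh] with [phi]
in place of [phih], hence [semi1_grad_proj_error]: the difference is bounded by
the L2 norm of [phi - phih] alone, for which the hypothesis provides the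
additional power of the mesh size.

What this rests on is that the weak derivative [wd], which is a chosen function,
behaves linearly under the inner product. That is the uniqueness of weak
derivatives, i.e. the fundamental lemma of the calculus of variations
([ip_test_ae_eq0]), and it needs smooth bumps: products of the functions
exp (- 1 / t) with affine arguments. The same functions, with steeper and
steeper slopes, approximate indicators of quadrants, and an integrable function
that integrates to zero over every quadrant vanishes almost everywhere
([quadrants_ae_eq0]). The other analytic input is that partial derivatives of
test functions integrate to zero ([integral_partial_eq0]); it makes classical
derivatives of test functions weak derivatives, and it gives the Poincare
inequality by testing against the function x1 z ([poincare_test]). *)

Set Implicit Arguments.
Unset Strict Implicit.
Unset Printing Implicit Defensive.

Import Order.TTheory GRing.Theory Num.Theory.
Import numFieldNormedType.Exports.

Local Open Scope classical_set_scope.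
Local Open Scope ring_scope.

(** * Semi-inner products and the L2 pairing *)

Section SemiInner.
Context {R : realType} {E : lmodType R}.
Implicit Types (D : set E) (B : E -> E -> R).

(** The forms below are only semidefinite, because they see functions up to null
sets of the domain, and they are meaningful only on [D]. *)
Record semi_inner D B : Prop := SemiInner {
  si_closed : forall k x y, D x -> D y -> D (x + k *: y);
  si_sym : forall x y, D x -> D y -> B x y = B y x;
  si_lin : forall k x y z, D x -> D y -> D z ->
    B (x + k *: y) z = B x z + k * B y z;
  si_ge0 : forall x, D x -> 0 <= B x x }.

Definition si_norm B x : R := Num.sqrt (B x x).

Lemma semi_innerD D B1 B2 : semi_inner D B1 -> semi_inner D B2 ->
  semi_inner D (fun x y => B1 x y + B2 x y).
Proof.
move=> h1 h2; split.
- exact: si_closed h1.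
- by move=> x y Dx Dy; rewrite (si_sym h1) // (si_sym h2).
- by move=> k x y z Dx Dy Dz; rewrite (si_lin h1) // (si_lin h2) //; lra.
- by move=> x Dx; rewrite addr_ge0 // ?(si_ge0 h1) ?(si_ge0 h2).
Qed.

Section Theory.
Variables (D : set E) (B : E -> E -> R).
Hypothesis h : semi_inner D B.
Local Notation N := (si_norm B).

Lemma si_sub x y : D x -> D y -> D (x - y).
Proof. by move=> Dx Dy; rewrite -scaleN1r; exact: si_closed h _ _ _ _ _. Qed.

Lemma si_add x y : D x -> D y -> D (x + y).
Proof. by move=> Dx Dy; rewrite -[y]scale1r; exact: si_closed h _ _ _ _ _. Qed.

Lemma si_linr k x y z : D x -> D y -> D z ->
  B z (x + k *: y) = B z x + k * B z y.
Proof.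
move=> Dx Dy Dz; rewrite (si_sym h) ?(si_lin h) //; last exact: (si_closed h).
by rewrite (si_sym h Dx) // (si_sym h Dy).
Qed.

Lemma si_Bl x y z : D x -> D y -> D z -> B (x - y) z = B x z - B y z.
Proof. by move=> *; rewrite -scaleN1r (si_lin h) // mulN1r. Qed.

Lemma si_Br x y z : D x -> D y -> D z -> B z (x - y) = B z x - B z y.
Proof. by move=> *; rewrite -scaleN1r si_linr // mulN1r. Qed.

Lemma si_Dl x y z : D x -> D y -> D z -> B (x + y) z = B x z + B y z.
Proof. by move=> *; rewrite -[y in LHS]scale1r (si_lin h) // mul1r. Qed.

Lemma si_norm_ge0 x : 0 <= N x. Proof. exact: sqrtr_ge0. Qed.

Lemma si_normE x : D x -> N x ^+ 2 = B x x.
Proof. by move=> Dx; rewrite sqr_sqrtr // (si_ge0 h). Qed.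

(** Nonnegativity of the quadratic [t |-> B (x + t y) (x + t y)]; when [B y y]
vanishes it is an affine function of [t], which forces [B x y = 0]. *)
Lemma si_CS x y : D x -> D y -> `|B x y| <= N x * N y.
Proof.
move=> Dx Dy; rewrite -ler_sqr ?nnegrE ?mulr_ge0 ?si_norm_ge0 //.
rewrite exprMn !si_normE // real_normK ?num_real //.
have q t : 0 <= B x x + 2 * t * B x y + t ^+ 2 * B y y.
  have /(si_ge0 h) := si_closed h t Dx Dy.
  rewrite (si_lin h) ?si_linr //; try exact: si_closed h _ _ _ _ _.
  by rewrite (si_sym h Dy Dx); lra.
have [c0|cN0] := eqVneq (B y y) 0.
  have [->|bN0] := eqVneq (B x y) 0; first by rewrite c0 expr0n /= mulr0.
  have := q (- (B x x + 1) / (B x y * 2)); rewrite c0.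
  have -> : 2 * (- (B x x + 1) / (B x y * 2)) * B x y = - (B x x + 1).
    have dN0 : B x y * 2 != 0 by rewrite mulf_neq0 ?pnatr_eq0.
    by rewrite -[RHS](divfK dN0); lra.
  by rewrite mulr0 addr0; lra.
have cgt0 : 0 < B y y by rewrite lt_def cN0 (si_ge0 h).
have e : (B y y)^-1 * B y y = 1 by rewrite mulVf.
have := mulr_ge0 (q (- (B x y * (B y y)^-1))) (ltW cgt0).
set a := B x x; set b := B x y; set c := B y y; set i := c^-1.
have -> : (a + 2 * - (b * i) * b + (- (b * i)) ^+ 2 * c) * c
   = a * c - 2 * b ^+ 2 * (i * c) + b ^+ 2 * (i * c) ^+ 2 by lra.
by rewrite e; lra.
Qed.

Lemma si_triangle x y : D x -> D y -> N (x + y) <= N x + N y.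
Proof.
move=> Dx Dy; rewrite -ler_sqr ?nnegrE ?addr_ge0 ?si_norm_ge0 //.
rewrite sqrrD !si_normE //; last exact: si_add.
have Dxy := si_add Dx Dy.
rewrite si_Dl // (si_sym h Dx) // (si_sym h Dy) // !si_Dl //.
have := le_trans (ler_norm _) (si_CS Dx Dy).
by rewrite (si_sym h Dy Dx); lra.
Qed.

Lemma si_normBC x y : D x -> D y -> N (x - y) = N (y - x).
Proof.
move=> Dx Dy; rewrite /si_norm; congr Num.sqrt.
have Dxy := si_sub Dx Dy; have Dyx := si_sub Dy Dx.
by rewrite !si_Bl // !si_Br // (si_sym h Dx Dy); lra.
Qed.

Lemma si_triangleB x y z : D x -> D y -> D z -> N (x - z) <= N (x - y) + N (y - z).
Proof.
move=> Dx Dy Dz; have -> : x - z = (x - y) + (y - z) by rewrite addrA subrK.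
by apply: si_triangle; exact: si_sub.
Qed.

End Theory.

End SemiInner.

Lemma semi_inner_comp {R : realType} {E F : lmodType R} (L : F -> E)
    (D' : set F) (D : set E) (B : E -> E -> R) :
  (forall k x y, L (x + k *: y) = L x + k *: L y) ->
  (forall k x y, D' x -> D' y -> D' (x + k *: y)) ->
  (forall x, D' x -> D (L x)) -> semi_inner D B ->
  semi_inner D' (fun x y => B (L x) (L y)).
Proof.
move=> Llin cD' LD h; split => //.
- by move=> x y Dx Dy; exact: (si_sym h (LD _ Dx) (LD _ Dy)).
- by move=> k x y z Dx Dy Dz; rewrite Llin (si_lin h) //; exact: LD.
- by move=> x Dx; exact: (si_ge0 h (LD _ Dx)).
Qed.

Section L2space.
Context {R : realType}.
Variable Omega : set (R * R).
Local Notation L2 := (L2 Omega).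
Local Notation ip := (ip Omega).
Local Notation leb2 := (@leb2 R).

Lemma ipE f g : ip f g = \int[leb2]_x ((f \_ Omega) x * (g \_ Omega) x).
Proof.
rewrite /ip Rintegral_mkcond; congr (Rintegral _ _ _); apply/funext => x.
by rewrite !patchE; case: ifP; rewrite ?mulr0.
Qed.

Lemma L2_integrableM f g : L2 f -> L2 g ->
  leb2.-integrable setT (EFin \o (fun x => (f \_ Omega) x * (g \_ Omega) x)).
Proof. by move=> hf hg; apply/Lfun1_integrable/Lfun2_mul_Lfun1. Qed.

Lemma patch_lin k (f g : R * R -> R) :
  (f + k *: g) \_ Omega = f \_ Omega + k *: (g \_ Omega).
Proof.
by apply/funext => x; rewrite !fctE !patchE; case: ifP; rewrite ?scaler0 ?addr0.
Qed.

Lemma L2_closed k f g : L2 f -> L2 g -> L2 (f + k *: g).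
Proof.
rewrite /L2 /= patch_lin => hf hg.
have p1 : (1 <= 2%:E :> \bar R)%E by rewrite lee_fin ler1n.
have [_ +] := Lfun_submod_closed leb2 p1; rewrite addrC; exact.
Qed.

Lemma semi_inner_ip : semi_inner L2 ip.
Proof.
split; first exact: L2_closed.
- move=> x y _ _; rewrite /ip; congr (Rintegral _ _ _).
  by apply/funext => z; rewrite mulrC.
- move=> k x y z hx hy hz; rewrite !ipE patch_lin.
  have i1 := L2_integrableM hx hz; have i2 := L2_integrableM hy hz.
  rewrite -(RintegralZl k measurableT i2) -RintegralD //.
  + by congr (Rintegral _ _ _); apply/funext => t; rewrite !fctE /GRing.scale /=; lra.
  + by apply: (integrableZl measurableT k) i2.
- by move=> x hx; apply: Rintegral_ge0 => t _; rewrite -expr2 sqr_ge0.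
Qed.

End L2space.

(** * A flat exponential *)

Section FlatExponential.
Context {R : realType}.
Implicit Types t : R.

(** The function [t ^- n * exp (- 1 / t)], extended by [0] to [t <= 0]. The
family indexed by [n] is used because differentiation maps it to combinations of
its members, so that smoothness follows by induction. *)
Definition flat_exp (n : nat) t : R :=
  if 0 < t then t^-1 ^+ n * expR (- t^-1) else 0.

Lemma flat_exp_eq0 n t : t <= 0 -> flat_exp n t = 0.
Proof. by rewrite leNgt /flat_exp => /negbTE ->. Qed.

Lemma flat_exp_ge0 n t : 0 <= flat_exp n t.
Proof.
rewrite /flat_exp; case: ifP => // t0.
by rewrite mulr_ge0 ?expR_ge0 // exprn_ge0 // invr_ge0 ltW.
Qed.

(** The exponential series dominates its term of degree [n + 2]. The two spare
powers of [t] make the function differentiable at [0], with derivative [0]. *)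
Lemma flat_exp_le n t : flat_exp n t <= n.+2`!%:R * t ^+ 2.
Proof.
rewrite /flat_exp; case: ifP => [t0|_]; last by rewrite mulr_ge0 // sqr_ge0.
have tN0 : t != 0 by rewrite gt_eqF.
have := @expR_ge1Dxn R t^-1 n.+1; rewrite invr_ge0 => /(_ (ltW t0)).
rewrite expRN => h.
have h' : t^-1 ^+ n.+2 <= n.+2`!%:R * expR t^-1.
  rewrite mulrC -ler_pdivrMr ?ltr0n ?fact_gt0 //.
  by apply: le_trans h; rewrite lerDr.
rewrite ler_pdivrMr ?expR_gt0 // mulrAC -ler_pdivrMr ?exprn_gt0 //.
by rewrite -exprVn -exprD addn2.
Qed.

Lemma is_derive_flat_exp n t :
  is_derive t 1 (flat_exp n) (flat_exp n.+2 t - n%:R * flat_exp n.+1 t).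
Proof.
have [t0|t0|->] := ltrgt0P t.
- have near_t : \near t, t^-1 ^+ n * expR (- t^-1) = flat_exp n t.
    near=> s; rewrite /flat_exp ifT //; near: s; exact: lt_nbhsr.
  apply: near_eq_is_derive near_t _.
  have tN0 : t != 0 by rewrite gt_eqF.
  have dV : is_derive t 1 (fun s : R => s^-1) (- t ^- 2).
    have := @is_deriveV R id t 1 1 tN0 (is_derive_id _ _).
    by rewrite /GRing.scale /= mulr1.
  have dN : is_derive t 1 (fun s : R => - s^-1) (t ^- 2).
    by have := is_deriveN dV; rewrite opprK.
  have dE : is_derive t 1 (fun s : R => expR (- s^-1)) (expR (- t^-1) * t ^- 2).
    exact: is_derive1_comp (is_derive_expR _) dN.
  have dX : is_derive t 1 (fun s : R => s^-1 ^+ n) (- n%:R * t^-1 ^+ n.+1).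
    have := is_deriveX n dV.
    have -> : (fun s : R => s^-1) ^+ n = (fun s => s^-1 ^+ n).
      by apply/funext => s; rewrite exprfctE.
    move=> /is_derive_eq; apply; rewrite /GRing.scale /=.
    case: n => [|m]; first by rewrite !mul0r ?oppr0 ?mul0r.
    by rewrite -exprVn !exprS; lra.
  apply: (is_derive_eq (is_deriveM dX dE)).
  by rewrite /GRing.scale /= /flat_exp t0 -exprVn !exprS; lra.
- have near_t : \near t, 0 = flat_exp n t.
    near=> s; rewrite /flat_exp ifF //; apply/negbTE; rewrite -leNgt ltW //.
    near: s; exact: lt_nbhsl.
  apply: near_eq_is_derive near_t _.
  by rewrite !(flat_exp_eq0 _ (ltW t0)) mulr0 subr0; exact: is_derive_cst.
(* At the origin the quadratic bound makes the difference quotient vanish. *)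
- have -> : flat_exp n.+2 0 - n%:R * flat_exp n.+1 0 = 0.
    by rewrite /flat_exp ltxx mulr0 subr0.
  have cv : (fun h => h^-1 *: ((flat_exp n \o shift 0) (h *: 1) - flat_exp n 0))
       @ 0^' --> (0 : R).
    apply/cvgr0Pnorm_lt => e e0; near=> h.
    have hN0 : h != 0 by near: h; exact: nbhs_dnbhs_neq.
    rewrite /= /GRing.scale /= mulr1 addr0 {2}/flat_exp ltxx subr0.
    rewrite normrM normfV (ger0_norm (flat_exp_ge0 _ _)).
    rewrite mulrC ltr_pdivrMr ?normr_gt0 //.
    apply: le_lt_trans (flat_exp_le _ _) _.
    rewrite -real_normK ?num_real // expr2 mulrA ltr_pM2r ?normr_gt0 //.
    rewrite mulrC -ltr_pdivlMr ?ltr0n ?fact_gt0 //.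
    near: h; apply: nbhs_dnbhs; apply: (@nbhs0_lt R R).
    by rewrite divr_gt0 // ltr0n fact_gt0.
  by split; [apply/cvg_ex; exists 0 | exact: cvg_lim cv].
Unshelve. all: by end_near. Qed.

Lemma derivable_flat_exp n t v : derivable (flat_exp n) t v.
Proof.
apply: diff_derivable; apply/derivable1_diffP.
by have [] := is_derive_flat_exp n t.
Qed.

Lemma derive_flat_exp n t v : 'D_v (flat_exp n) t =
  v * (flat_exp n.+2 t - n%:R * flat_exp n.+1 t).
Proof.
have [dt <-] := is_derive_flat_exp n t.
move/derivable1_diffP in dt; rewrite !deriveE //.
by rewrite -[v in LHS]mulr1 -[v * 1]/(v *: (1 : R)) linearZ.
Qed.

Lemma continuous_flat_exp n : continuous (flat_exp n).
Proof.
move=> t; apply: differentiable_continuous; apply/derivable1_diffP.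
by have [] := is_derive_flat_exp n t.
Qed.

Lemma flat_exp_le1 t : flat_exp 0 t <= 1.
Proof.
rewrite /flat_exp; case: ifP => // t0; rewrite expr0 mul1r expR_le1 oppr_le0.
by rewrite invr_ge0 ltW.
Qed.

Lemma flat_exp_gt0 n t : 0 < t -> 0 < flat_exp n t.
Proof.
by move=> t0; rewrite /flat_exp t0 mulr_gt0 ?expR_gt0 // exprn_gt0 // invr_gt0.
Qed.

(** Sharpening the slope turns the flat exponential into a half-line indicator. *)
Lemma cvg_flat_exp t :
  flat_exp 0 (k%:R * t) @[k --> \oo] --> (if 0 < t then 1 else 0 : R).
Proof.
case: ifP => t0; last first.
  apply: cvg_near_cst; near=> k.
  rewrite flat_exp_eq0 // mulr_ge0_le0 // leNgt t0 //.
have : expR (- (k%:R * t)^-1) @[k --> \oo] --> expR (- 0 : R).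
  apply: continuous_cvg; first exact: continuous_expR.
  apply: cvgN; apply/cvgr0Pnorm_lt => e e0; near=> k.
  rewrite normfV normrM (gtr0_norm t0) ger0_norm //.
  have k0 : 0 < k%:R :> R by rewrite ltr0n; near: k; exact: nbhs_infty_gt.
  rewrite -ltf_pV2 ?posrE ?invr_gt0 ?mulr_gt0 // invrK -ltr_pdivrMr //.
  near: k; exact: nbhs_infty_gtr.
rewrite oppr0 expR0; apply: cvg_trans; apply: near_eq_cvg; near=> k.
rewrite /flat_exp mulr_gt0 //; first by rewrite expr0 mul1r.
by rewrite ltr0n; near: k; exact: nbhs_infty_gt.
Unshelve. all: by end_near. Qed.

End FlatExponential.

(** * Smooth functions and test functions on the plane *)

Section SmoothFunctions.
Context {R : realType}.
Implicit Types (f g : R * R -> R) (x e : R * R).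

Definition smooth f : Prop := forall k, Ck k f.

Lemma Ck_continuous k f : Ck k f -> continuous f.
Proof. by case: k => [|k] []. Qed.

Lemma Ck_pred k f : Ck k.+1 f -> Ck k f.
Proof.
elim: k f => [|k IH] f [cf df]; split => // e he.
by have [dfe Cfe] := df e he; split => //; exact: IH.
Qed.

Lemma Ck_cst k (c : R) : Ck k (cst c : R * R -> R).
Proof.
elim: k c => [|k IH] c; split; try exact: cst_continuous; first by [].
move=> e _; split; first by move=> x; exact: derivable_cst.
have -> : (fun x => 'D_e (cst c : R * R -> R) x) = cst 0; last exact: IH.
by apply/funext => x; rewrite derive_cst.
Qed.

Lemma CkD k f g : Ck k f -> Ck k g -> Ck k (f + g).
Proof.
elim: k f g => [|k IH] f g [cf df] [cg dg]; split => //;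
  try by move=> x; apply: cvgD; [exact: cf|exact: cg].
move=> e he; have [dfe Cfe] := df e he; have [dge Cge] := dg e he.
split; first by move=> x; apply: derivableD.
have -> : (fun x => 'D_e (f + g) x) = (fun x => 'D_e f x) + (fun x => 'D_e g x).
  by apply/funext => x; rewrite deriveD.
exact: IH.
Qed.

Lemma CkM k f g : Ck k f -> Ck k g -> Ck k (f * g).
Proof.
elim: k f g => [|k IH] f g Cf Cg; have [cf df] := Cf; have [cg dg] := Cg; split => //;
  try by move=> x; apply: cvgM; [exact: cf|exact: cg].
move=> e he; have [dfe Cfe] := df e he; have [dge Cge] := dg e he.
split; first by move=> x; apply: derivableM.
have -> : (fun x => 'D_e (f * g) x) =
    f * (fun x => 'D_e g x) + g * (fun x => 'D_e f x).
  by apply/funext => x; rewrite deriveM.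
by apply: CkD; apply: IH => //; exact: Ck_pred.
Qed.

Lemma smooth_cst (c : R) : smooth (cst c : R * R -> R).
Proof. by move=> k; exact: Ck_cst. Qed.

Lemma smoothD f g : smooth f -> smooth g -> smooth (f + g).
Proof. by move=> hf hg k; exact: CkD. Qed.

Lemma smoothM f g : smooth f -> smooth g -> smooth (f * g).
Proof. by move=> hf hg k; exact: CkM. Qed.

Lemma smooth_continuous f : smooth f -> continuous f.
Proof. by move=> /(_ 0%N)/Ck_continuous. Qed.

Lemma smooth_derivable f e x : smooth f -> e = e1 \/ e = e2 -> derivable f x e.
Proof. by move=> /(_ 1%N) [_ h] he; have [+ _] := h e he. Qed.

Lemma smooth_derive f e : smooth f -> e = e1 \/ e = e2 ->
  smooth (fun x => 'D_e f x).
Proof. by move=> sf he k; have [_ h] := sf k.+1; have [_ +] := h e he. Qed.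

Section Affine.
Variables (a b c : R).

Definition affine x : R := a * x.1 + b * x.2 + c.

Lemma continuous_affine : continuous affine.
Proof.
move=> x; apply: cvgD; last exact: cvg_cst.
by apply: cvgD; apply: cvgM; try exact: cvg_cst; [exact: cvg_fst|exact: cvg_snd].
Qed.

(** Since [affine] is affine along lines, the difference quotients of a composite
are literally difference quotients in dimension one. *)
Let affine_quotient (h : R -> R) x e :
  (fun t => t^-1 *: ((h \o affine \o shift x) (t *: e) - (h \o affine) x)) =
  (fun t => t^-1 *:
     ((h \o shift (affine x)) (t *: (a * e.1 + b * e.2)) - h (affine x))).
Proof.
apply/funext => t /=; congr (_ *: (h _ - _)).
by rewrite /affine /= /GRing.scale /=; lra.
Qed.

Lemma derivable_comp_affine (h : R -> R) x e :
  derivable h (affine x) (a * e.1 + b * e.2) -> derivable (h \o affine) x e.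
Proof. by rewrite /derivable affine_quotient. Qed.

Lemma derive_comp_affine (h : R -> R) x e :
  'D_e (h \o affine) x = 'D_(a * e.1 + b * e.2) h (affine x).
Proof. by rewrite /derive affine_quotient. Qed.

Lemma smooth_flat_exp_affine n : smooth (flat_exp n \o affine).
Proof.
move=> k; elim: k n => [|k IH] n.
  split=> // x; apply: continuous_comp; first exact: continuous_affine.
  exact: continuous_flat_exp.
split=> [|e _].
  move=> x; apply: continuous_comp; first exact: continuous_affine.
  exact: continuous_flat_exp.
split; first by move=> x; exact/derivable_comp_affine/derivable_flat_exp.
have -> : (fun x => 'D_e (flat_exp n \o affine) x) =
    cst (a * e.1 + b * e.2) *
      ((flat_exp n.+2 \o affine) + cst (- n%:R) * (flat_exp n.+1 \o affine)).
  apply/funext => x; rewrite derive_comp_affine derive_flat_exp.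
  by rewrite !fctE /= mulNr.
by apply: CkM; first exact: Ck_cst; apply: CkD => //; apply: CkM => //; exact: Ck_cst.
Qed.

Lemma smooth_affine : smooth affine.
Proof.
case=> [|k]; first by split => //; exact: continuous_affine.
split=> [|e _]; first exact: continuous_affine.
have E x : 'D_e affine x = a * e.1 + b * e.2.
  rewrite -[affine]/(id \o affine) derive_comp_affine derive_id.
  by [].
split; last by under eq_fun do rewrite E; exact: Ck_cst.
by move=> x; apply: (@derivable_comp_affine id); exact: derivable_id.
Qed.

End Affine.

Variable Omega : set (R * R).

Lemma test_fun_smooth f : test_fun Omega f -> smooth f.
Proof. by case. Qed.

Lemma test_fun_intro f (K : set (R * R)) : smooth f -> compact K ->
  K `<=` Omega -> (forall x, ~ K x -> f x = 0) -> test_fun Omega f.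
Proof.
move=> sf cK KO fK.
have clK : closed K by apply: compact_closed => //; exact: norm_hausdorff.
have sK : closure [set x | f x != 0] `<=` K.
  rewrite [X in _ `<=` X](closure_id K).1 //; apply: closureS => x /= fx.
  by apply: contrapT => /fK fx0; rewrite fx0 eqxx in fx.
split => //; last exact: subset_trans sK KO.
by apply: subclosed_compact cK sK; exact: closed_closure.
Qed.

Definition supp f : set (R * R) := closure [set x | f x != 0].

Lemma supp_eq0 f x : ~ supp f x -> f x = 0.
Proof.
move=> hx; apply: contrapT => /eqP fx; apply: hx; exact: subset_closure.
Qed.

Lemma test_fun_closed f g (k : R) : test_fun Omega f -> test_fun Omega g ->
  test_fun Omega (f + k *: g).
Proof.
move=> [sf cf Of] [sg cg Og].
have sfg : smooth (f + k *: g).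
  apply: smoothD => //; have -> : k *: g = cst k * g by apply/funext.
  by apply: smoothM => //; exact: smooth_cst.
apply: (test_fun_intro sfg (compactU cf cg)) => [x [/Of|/Og] //|x /not_orP [hf hg]].
by rewrite !fctE (supp_eq0 hf) (supp_eq0 hg) scaler0 addr0.
Qed.

Lemma test_funM f g : smooth f -> test_fun Omega g -> test_fun Omega (f * g).
Proof.
move=> sf [sg cg Og]; apply: (test_fun_intro (smoothM sf sg) cg Og) => x hx.
by rewrite !fctE (supp_eq0 hx) mulr0.
Qed.

Lemma derive_supp f e x : ~ supp f x -> 'D_e f x = 0.
Proof.
move=> hx; rewrite -(@derive_cst R (R * R)%type R (0 : R) e x).
apply: near_eq_derive.
have : open (~` supp f) by apply: closed_openC; exact: closed_closure.
rewrite openE => /(_ _ hx); rewrite /interior.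
by apply: filterS => y; exact: supp_eq0.
Qed.

Lemma test_fun_derive f e : test_fun Omega f -> e = e1 \/ e = e2 ->
  test_fun Omega (fun x => 'D_e f x).
Proof.
move=> [sf cf Of] he; apply: (test_fun_intro _ cf Of); first exact: smooth_derive.
by move=> x; exact: derive_supp.
Qed.

End SmoothFunctions.

(** * Integration on the plane *)

Section PlaneMeasure.
Context {R : realType}.
Local Notation leb2 := (@leb2 R).
Local Notation mu := (@lebesgue_measure R).
Local Notation mR2 := (measurableTypeR R * measurableTypeR R)%type.
Implicit Types (f : R * R -> R).

Definition obox (q : R * R) (r : R) : set (R * R) :=
  `]q.1 - r, q.1 + r[ `*` `]q.2 - r, q.2 + r[.

Definition cbox (q : R * R) (r : R) : set (R * R) :=
  `[q.1 - r, q.1 + r] `*` `[q.2 - r, q.2 + r].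

(** Boxes with rational centre and radius [1 / (n + 1)]. They form a countable
base, which yields Borel measurability of open sets and a countable family of
bumps that detects every point of an open set. *)
Definition ratbox (i : rat * rat * nat) : (R * R) * R :=
  ((ratr i.1.1, ratr i.1.2), i.2.+1%:R^-1).

Lemma measurable_obox q r : measurable (obox q r : set mR2).
Proof. by apply: measurableX; exact: measurable_itv. Qed.

Lemma measurable_cbox q r : measurable (cbox q r : set mR2).
Proof. by apply: measurableX; exact: measurable_itv. Qed.

Lemma compact_cbox q r : compact (cbox q r).
Proof. by apply: compact_setX; exact: segment_compact. Qed.

Lemma open_ratbox (U : set (R * R)) x : open U -> U x ->
  exists i, obox (ratbox i).1 (ratbox i).2 x /\
            cbox (ratbox i).1 (ratbox i).2 `<=` U.
Proof.
rewrite openE => /(_ x)/[apply]; rewrite /interior => /nbhs_ballP[e /= e0 eU].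
have [n hn] : exists n, n.+1%:R^-1 < e / 2.
  have e20 : 0 < (e / 2)^-1 by rewrite invr_gt0 divr_gt0.
  exists (Num.bound (e / 2)^-1).
  rewrite -ltf_pV2 ?posrE ?invr_gt0 // ?invrK ?divr_gt0 //.
  by apply: lt_trans (archi_boundP (ltW e20)) _; rewrite ltr_nat.
set r : R := n.+1%:R^-1 in hn.
have r0 : 0 < r by rewrite invr_gt0.
have [q1 h1] : exists q, ratr q \in `]x.1 - r, x.1 + r[%R.
  by apply: rat_in_itvoo; lra.
have [q2 h2] : exists q, ratr q \in `]x.2 - r, x.2 + r[%R.
  by apply: rat_in_itvoo; lra.
exists (q1, q2, n); rewrite /ratbox /= -/r.
move: h1 h2; rewrite !in_itv /= => /andP[h1 h1'] /andP[h2 h2'].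
split; first by split; rewrite /= in_itv /=; apply/andP; split; lra.
move=> y [] /=; rewrite !in_itv /= => /andP[k1 k1'] /andP[k2 k2'].
by apply: eU; split; rewrite /ball /= ltr_norml; apply/andP; split; lra.
Qed.

Lemma open_measurable2 (U : set (R * R)) : open U -> measurable (U : set mR2).
Proof.
move=> oU.
have -> : U = \bigcup_i (if pselect (cbox (ratbox i).1 (ratbox i).2 `<=` U)
    then obox (ratbox i).1 (ratbox i).2 else set0).
  apply/seteqP; split=> [x Ux|x [i _]].
    have [i [xi iU]] := open_ratbox oU Ux; exists i => //.
    by case: pselect.
  case: pselect => //= iU [/= h1 h2]; apply: iU; split => /=;
    exact: subset_itv_oo_cc.
apply: countable_bigcupT_measurable => [|i]; first exact: countableP.
by case: ifP => _; [exact: measurable_obox|exact: measurable0].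
Qed.

Lemma continuous_measurable2 f : continuous f -> measurable_fun (setT : set mR2) f.
Proof.
move=> /continuousP cf; apply: (measurability _ (RGenOInfty.measurableE R)).
move=> _ [_ [a ->] <-]; rewrite setTI; apply: open_measurable2.
by apply: cf; exact: interval_open.
Qed.

Lemma compact_supp_box f : compact (supp f) ->
  exists M : R, 0 < M /\ forall x, ~ cbox (0, 0) M x -> f x = 0.
Proof.
move=> /compact_bounded [M0 [_ hM]]; pose M := `|M0| + 1.
exists M; split; first by rewrite /M ltr_wpDl.
move=> x hx; apply: contrapT => /eqP fx; apply: hx.
have M0M : M0 < M by rewrite /M (le_lt_trans (ler_norm _)) // ltrDl.
have /(hM M M0M) : supp f x by exact: subset_closure.
rewrite /= prod_normE ge_max => /andP[h1 h2].
by split; rewrite /= !sub0r !add0r in_itv /= -ler_norml.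
Qed.

Lemma compact_supp_bounded f : continuous f -> compact (supp f) ->
  exists C : R, 0 <= C /\ forall x, `|f x| <= C.
Proof.
move=> cf cs.
have /compact_bounded [M0 [_ hM]] : compact (f @` supp f).
  by apply: continuous_compact cs; exact: continuous_subspaceT.
exists (`|M0| + 1); split; first by rewrite addr_ge0.
move=> x; have [sx|/supp_eq0 ->] := pselect (supp f x).
  apply: hM; last by exists x.
  by rewrite (le_lt_trans (ler_norm _)) // ltrDl.
by rewrite normr0 addr_ge0.
Qed.

Lemma leb2_cbox q r : (leb2 (cbox q r) < +oo)%E.
Proof.
rewrite /leb2 product_measure1E; [|exact: measurable_itv..].
rewrite /= !lebesgue_measure_itv /=.
by case: ifP; case: ifP; rewrite -?EFinB -?EFinM ?ltry ?mule0 ?mul0e ?ltry.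
Qed.

Lemma continuous_integrable f : continuous f -> compact (supp f) ->
  leb2.-integrable setT (EFin \o f).
Proof.
move=> cf cs; have [M [M0 hM]] := compact_supp_box cs.
have [C [C0 hC]] := compact_supp_bounded cf cs.
have mf : measurable_fun (setT : set mR2) f by exact: continuous_measurable2.
have -> : EFin \o f = (EFin \o f) \_ (cbox (0, 0) M).
  apply/funext => x; rewrite patchE; case: ifPn => //= hx.
  by rewrite hM //; move: hx; rewrite notin_setE.
apply/(integrable_mkcond _ (measurable_cbox _ _)).
apply: measurable_bounded_integrable.
- exact: measurable_cbox.
- exact: leb2_cbox.
- exact: measurable_funTS.
- exists C; split; first exact: num_real.
  by move=> D CD x _; exact: le_trans (hC x) (ltW CD).
Qed.

Lemma supp_sub f g : (forall x, f x = 0 -> g x = 0) -> compact (supp f) ->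
  compact (supp g).
Proof.
move=> fg cs; apply: subclosed_compact cs _; first exact: closed_closure.
by apply: closureS => x /=; apply: contra_neq; exact: fg.
Qed.

Lemma continuous_Lfun2 f : continuous f -> compact (supp f) ->
  f \in Lfun leb2 2%:E.
Proof.
move=> cf cs; rewrite inE; apply/andP; split; rewrite inE /=.
  exact: continuous_measurable2.
rewrite /finite_norm unlock /=; apply: poweR_lty.
have : leb2.-integrable setT (EFin \o (f * f)).
  apply: continuous_integrable; first by move=> x; apply: cvgM; exact: cf.
  by apply: supp_sub cs => x; rewrite !fctE => ->; rewrite mulr0.
move=> /integrableP[_]; apply: le_lt_trans; apply: ge0_le_integral => //.
- apply/measurable_EFinP.
  apply/(@measurableT_comp _ _ _ _ _ _ (fun x : R => x `^ 2)%R) => //.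
  by apply: measurableT_comp => //; exact: continuous_measurable2.
- apply: measurableT_comp => //; apply/measurable_EFinP.
  by apply: measurable_funM; exact: continuous_measurable2.
- by move=> x _ /=; rewrite lee_fin normrM powR_mulrn.
Qed.

(** The fundamental theorem of calculus on an interval that is strictly larger
than [[- M, M]], so that [g] vanishes at both ends. *)
Lemma integral_derive_eq0 (g dg : R -> R) (M : R) : 0 < M ->
  (forall t, is_derive t (1 : R) g (dg t)) -> continuous dg ->
  (forall t, t \notin `[- M, M] -> g t = 0 /\ dg t = 0) ->
  (\int[mu]_t (dg t)%:E = 0)%E.
Proof.
move=> M0 dgE cdg hM; pose L := M + 1.
have cg : continuous g.
  by move=> t; apply: differentiable_continuous; apply/derivable1_diffP; case: (dgE t).
transitivity (\int[mu]_(t in [set` `[- L, L]%R]) (dg t)%:E)%E.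
  rewrite [RHS]integral_mkcond; apply: eq_integral => t _; rewrite patchE.
  case: ifPn => //; rewrite notin_setE /= in_itv /= => ht.
  have [//|_ ->//] := hM t; apply/negP; rewrite in_itv /= => /andP[h1 h2].
  by apply: ht; apply/andP; split; rewrite /L; lra.
rewrite (@continuous_FTC2 _ dg g).
- have [|-> _] := hM L; first
    by rewrite in_itv /= negb_and /L -!ltNge; apply/orP; right; lra.
  have [|-> _] := hM (- L); first
    by rewrite in_itv /= negb_and /L -!ltNge; apply/orP; left; lra.
  by rewrite sube0.
- by rewrite /L; lra.
- exact: continuous_subspaceT.
- split; first by move=> t _; have [] := dgE t.
    by apply: cvg_at_right_filter; exact: cg.
  by apply: cvg_at_left_filter; exact: cg.
- by move=> t _; rewrite derive1E; have [] := dgE t.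
Qed.

Lemma continuous_pairl (y : R) : continuous ((fun t => (t, y)) : R -> R * R).
Proof.
move=> t; exact: (@cvg_pair R R R (nbhs t) (nbhs t) (nbhs y) _ _ _
  id (cst y) cvg_id (cvg_cst y)).
Qed.

Lemma continuous_pairr (y : R) : continuous ((fun t => (y, t)) : R -> R * R).
Proof.
move=> t; exact: (@cvg_pair R R R (nbhs t) (nbhs y) (nbhs t) _ _ _
  (cst y) id (cvg_cst y) cvg_id).
Qed.

(** Fubini: integrate first along the lines parallel to [e], where the integral
of the derivative of a compactly supported function is zero. *)
Lemma integral_partial_eq0 f e : smooth f -> compact (supp f) ->
  e = e1 \/ e = e2 -> (\int[leb2]_x ('D_e f x)%:E = 0)%E.
Proof.
move=> sf cs he; have sD := smooth_derive sf he.
have csD : compact (supp (fun x => 'D_e f x)).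
  apply: subclosed_compact cs _; first exact: closed_closure.
  rewrite [X in _ `<=` X](closure_id (supp f)).1; last exact: closed_closure.
  apply: closureS => x /= hx; apply: contrapT => h.
  by move/eqP: hx; apply; exact: derive_supp.
have iD := continuous_integrable (smooth_continuous sD) csD.
have [M [M0 hM]] := compact_supp_box cs.
have [M' [M'0 hM']] := compact_supp_box csD.
pose L := M + M'.
have cD := smooth_continuous sD.
have out (x : R * R) : (x.1 \notin `[- L, L] \/ x.2 \notin `[- L, L]) ->
    f x = 0 /\ 'D_e f x = 0.
  move=> hx; split; [apply: hM|apply: hM']; rewrite /cbox /= !sub0r !add0r;
   case=> /=; rewrite !in_itv /= => /andP[a1 a2] /andP[a3 a4];
   case: hx => /negP; apply; rewrite in_itv /=; apply/andP; split; rewrite /L; lra.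
case: he => he.
- have inner (y : R) : (\int[mu]_t ('D_e f (t, y))%:E = 0)%E.
    apply: (@integral_derive_eq0 (fun t => f (t, y)) _ L); first by rewrite /L; lra.
    + move=> t; have := @smooth_derivable R f e (t, y) sf (or_introl he).
      have E : (fun h : R => h^-1 *: ((f \o shift (t, y)) (h *: e) - f (t, y))) =
        (fun h => h^-1 *: (((fun t => f (t, y)) \o shift t) (h *: 1) - f (t, y))).
        apply/funext => h /=; congr (_ *: (f _ - _)); rewrite he.
        by congr pair; rewrite /= scaler0 add0r.
      by rewrite /derivable E => dE; split => //; rewrite /derive -E.
    + move=> t; apply: (@continuous_comp _ _ _ (fun t : R => (t, y))
        (fun x => 'D_e f x)); last exact: cD.
      exact: continuous_pairl.
    + by move=> t ht; apply: out; left.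
  rewrite -(integral21_prod_meas1 iD) /fubini_G.
  by rewrite (eq_integral (cst 0%E)) ?integral0 // => y _ /=; exact: inner.
- have inner (y : R) : (\int[mu]_t ('D_e f (y, t))%:E = 0)%E.
    apply: (@integral_derive_eq0 (fun t => f (y, t)) _ L); first by rewrite /L; lra.
    + move=> t; have := @smooth_derivable R f e (y, t) sf (or_intror he).
      have E : (fun h : R => h^-1 *: ((f \o shift (y, t)) (h *: e) - f (y, t))) =
        (fun h => h^-1 *: (((fun t => f (y, t)) \o shift t) (h *: 1) - f (y, t))).
        apply/funext => h /=; congr (_ *: (f _ - _)); rewrite he.
        by congr pair; rewrite /= scaler0 add0r.
      by rewrite /derivable E => dE; split => //; rewrite /derive -E.
    + move=> t; apply: (@continuous_comp _ _ _ (fun t : R => (y, t))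
        (fun x => 'D_e f x)); last exact: cD.
      exact: continuous_pairr.
    + by move=> t ht; apply: out; right.
  rewrite -(integral12_prod_meas1 iD) /fubini_F.
  by rewrite (eq_integral (cst 0%E)) ?integral0 // => y _ /=; exact: inner.
Qed.

End PlaneMeasure.

(** * The fundamental lemma of the calculus of variations *)

Section ZeroAlmostEverywhere.
Context {R : realType}.
Local Notation leb2 := (@leb2 R).
Local Notation mR2 := (measurableTypeR R * measurableTypeR R)%type.

Definition quadrant (a b : R) : set (R * R) := `]a, +oo[ `*` `]b, +oo[.

Definition quadrants : set (set (R * R)) :=
  [set A | exists a b, A = quadrant a b].

Lemma measurable_quadrant a b : measurable (quadrant a b : set mR2).
Proof. by apply: measurableX; exact: measurable_itv. Qed.

Lemma quadrants_setI : setI_closed quadrants.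
Proof.
move=> _ _ [a [b ->]] [a' [b' ->]]; exists (Num.max a a'), (Num.max b b').
apply/seteqP; split=> [[x y] /=|[x y] /=];
  rewrite /quadrant /= !in_itv /= !andbT !gt_max.
  by move=> [[-> ->] [-> ->]].
by move=> [/andP[-> ->] /andP[-> ->]].
Qed.

Lemma itv_gtN_cover (t : R) : exists k : nat, - k%:R < t.
Proof.
exists (Num.bound `|t|); rewrite ltrNl; apply: le_lt_trans (archi_boundP (normr_ge0 t)).
by rewrite -normrN ler_norm.
Qed.

(** Vertical and horizontal open half-planes are countable increasing unions of
quadrants, hence both projections are measurable for the generated sigma-algebra. *)
Lemma measurable_quadrants (A : set mR2) : measurable A -> <<s quadrants >> A.
Proof.
have m1 : @measurable_fun _ _ (g_sigma_algebraType quadrants)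
    (measurableTypeR R) setT fst.
  apply: (measurability _ (RGenOInfty.measurableE R)) => _ [_ [a ->] <-].
  have -> : setT `&` fst @^-1` `]a, +oo[ = \bigcup_k quadrant a (- k%:R).
    rewrite setTI; apply/seteqP; split=> [[x y] /= xa|[x y] [k _] []] //.
    have [k ky] := itv_gtN_cover y; exists k => //.
    by split => //=; rewrite in_itv /= andbT.
  apply: bigcupT_measurable => k; apply: sub_sigma_algebra.
  by exists a, (- k%:R).
have m2 : @measurable_fun _ _ (g_sigma_algebraType quadrants)
    (measurableTypeR R) setT snd.
  apply: (measurability _ (RGenOInfty.measurableE R)) => _ [_ [a ->] <-].
  have -> : setT `&` snd @^-1` `]a, +oo[ = \bigcup_k quadrant (- k%:R) a.
    rewrite setTI; apply/seteqP; split=> [[x y] /= xa|[x y] [k _] []] //.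
    have [k ky] := itv_gtN_cover x; exists k => //.
    by split => //=; rewrite in_itv /= andbT.
  apply: bigcupT_measurable => k; apply: sub_sigma_algebra.
  by exists (- k%:R), a.
apply: smallest_sub; first exact: smallest_sigma_algebra.
by move=> _ [[B mB <-]|[B mB <-]]; [exact: m1|exact: m2].
Qed.

(** Quadrants form a pi-system generating the Borel sets, and the sets over
which an integrable function has integral zero form a Dynkin system. *)
Lemma quadrants_ae_eq0 (H : R * R -> R) :
  leb2.-integrable setT (EFin \o H) ->
  (\int[leb2]_x (H x)%:E = 0)%E ->
  (forall a b, \int[leb2]_(x in quadrant a b) (H x)%:E = 0)%E ->
  {ae leb2, forall x, H x = 0}.
Proof.
move=> iH HT Hq.
pose Z := [set A : set mR2 | measurable A /\ (\int[leb2]_(x in A) (H x)%:E = 0)%E].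
have iHA (A : set mR2) : measurable A -> leb2.-integrable A (EFin \o H).
  by move=> mA; exact: integrableS iH.
have dZ : dynkin Z.
  split; first by split.
  - move=> A [mA A0]; split; first exact: measurableC.
    have := @integral_setU _ _ _ leb2 A (~` A) (EFin \o H) mA (measurableC mA).
    rewrite setUv /= HT A0 add0e => <- //; last by rewrite disj_set2E setICr.
    exact: measurable_int iH.
  - move=> F tF ZF; have mF k : measurable (F k) by have [] := ZF k.
    split; first exact: bigcupT_measurable.
    rewrite (@integral_bigcup _ _ _ leb2 F (EFin \o H)) //.
      by apply: eseries0 => k _ _; have [] := ZF k.
    by apply: iHA; exact: bigcupT_measurable.
have HA (A : set mR2) : measurable A -> (\int[leb2]_(x in A) (H x)%:E = 0)%E.
  move=> /measurable_quadrants.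
  rewrite -(setI_closed_g_dynkin_g_sigma_algebra quadrants_setI).
  move=> /(_ Z) h; have [] // : Z A; apply: h; split => //.
  by move=> _ [a [b ->]]; split; [exact: measurable_quadrant|exact: Hq].
have : ae_eq leb2 setT (EFin \o H) (cst 0%E).
  apply: integral_ae_eq => // E _ mE; by rewrite integral0 HA.
by apply: filterS => x /(_ I) /= [].
Qed.

End ZeroAlmostEverywhere.

Section FundamentalLemma.
Context {R : realType}.
Variable Omega : set (R * R).
Hypothesis openO : open Omega.
Local Notation leb2 := (@leb2 R).
Local Notation L2 := (L2 Omega).
Local Notation ip := (ip Omega).
Local Notation mR2 := (measurableTypeR R * measurableTypeR R)%type.

Lemma test_fun_patch z : test_fun Omega z -> z \_ Omega = z.
Proof.
move=> [_ _ sO]; apply/funext => x; rewrite patchE; case: ifPn => // xO.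
by rewrite (@supp_eq0 _ z x) // => /sO; move: xO; rewrite notin_setE.
Qed.

Lemma test_fun_L2 z : test_fun Omega z -> L2 z.
Proof.
move=> tz; rewrite /L2 /= (test_fun_patch tz); case: tz => sz cz _.
by apply: continuous_Lfun2 => //; exact: smooth_continuous.
Qed.

Lemma ip_integral (f g : R * R -> R) : L2 f -> L2 g ->
  (\int[leb2]_x ((f \_ Omega) x * (g \_ Omega) x)%:E = (ip f g)%:E)%E.
Proof.
move=> hf hg; rewrite ipE /Rintegral fineK //.
exact: integrable_fin_num (L2_integrableM hf hg).
Qed.

(** A smooth approximation of the indicator of a quadrant as the slope [n] grows.
Its support is unbounded: it is meant to be multiplied by a bump. *)
Definition quadrant_step n (a b : R) : R * R -> R :=
  (flat_exp 0 \o affine n 0 (- (n * a))) * (flat_exp 0 \o affine 0 n (- (n * b))).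

Lemma smooth_quadrant_step n a b : smooth (quadrant_step n a b).
Proof. by apply: smoothM; exact: smooth_flat_exp_affine. Qed.

Lemma quadrant_step_ge0_le1 n a b x : 0 <= quadrant_step n a b x <= 1.
Proof.
rewrite /quadrant_step fctE mulr_ge0 ?flat_exp_ge0 //=.
by rewrite mulr_ile1 ?flat_exp_ge0 ?flat_exp_le1.
Qed.

Lemma cvg_quadrant_step a b x :
  quadrant_step k%:R a b x @[k --> \oo] --> (\1_(quadrant a b) x : R).
Proof.
have E (k : nat) : quadrant_step k%:R a b x =
    flat_exp 0 (k%:R * (x.1 - a)) * flat_exp 0 (k%:R * (x.2 - b)).
  by rewrite /quadrant_step fctE /affine /=; congr (flat_exp 0 _ * flat_exp 0 _); lra.
under eq_fun do rewrite E.
have -> : (\1_(quadrant a b) x : R) =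
    (if 0 < x.1 - a then 1 else 0) * (if 0 < x.2 - b then 1 else 0).
  rewrite indicE !subr_gt0; case: ifP => h1; case: ifP => h2;
    rewrite ?mul1r ?mulr0 ?mul0r ?mulr1.
  - by rewrite mem_set // /quadrant; split; rewrite /= in_itv /= andbT.
  - by rewrite memNset // /quadrant => -[/= _]; rewrite in_itv /= andbT h2.
  - by rewrite memNset // /quadrant => -[/=]; rewrite in_itv /= andbT h1.
  - by rewrite memNset // /quadrant => -[/=]; rewrite in_itv /= andbT h1.
by apply: cvgM; exact: cvg_flat_exp.
Qed.

Definition bump (q : R * R) (r : R) : R * R -> R :=
  (flat_exp 0 \o affine 1 0 (r - q.1)) * (flat_exp 0 \o affine (-1) 0 (q.1 + r)) *
  ((flat_exp 0 \o affine 0 1 (r - q.2)) * (flat_exp 0 \o affine 0 (-1) (q.2 + r))).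

Lemma test_fun_bump q r : cbox q r `<=` Omega -> test_fun Omega (bump q r).
Proof.
move=> qO; apply: (@test_fun_intro _ _ _ (cbox q r)) => //.
- by do !apply: smoothM; exact: smooth_flat_exp_affine.
- exact: compact_cbox.
- move=> x hx; rewrite /bump !fctE /= /affine.
  have [h1|h1] := ltP x.1 (q.1 - r).
    by rewrite (@flat_exp_eq0 _ _ (1 * _ + _ + _)) ?mul0r //; lra.
  have [h2|h2] := ltP (q.1 + r) x.1.
    by rewrite (@flat_exp_eq0 _ _ (-1 * _ + _ + _)) ?mulr0 ?mul0r //; lra.
  have [h3|h3] := ltP x.2 (q.2 - r).
    by rewrite (@flat_exp_eq0 _ _ (0 * _ + 1 * _ + _)) ?mul0r ?mulr0 //; lra.
  have [h4|h4] := ltP (q.2 + r) x.2.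
    by rewrite (@flat_exp_eq0 _ _ (0 * _ + -1 * _ + _)) ?mulr0 //; lra.
  by exfalso; apply: hx; split; rewrite /= in_itv /=; apply/andP.
Qed.

Lemma bump_gt0 q r x : obox q r x -> 0 < bump q r x.
Proof.
move=> [] /=; rewrite !in_itv /= => /andP[h1 h2] /andP[h3 h4].
by rewrite /bump !fctE /= /affine !mulr_gt0 // flat_exp_gt0 //; lra.
Qed.

(** The fundamental lemma of the calculus of variations. A bump multiplied by
quadrant steps is still a test function, so by dominated convergence the product
of [g] with the bump integrates to zero over every quadrant and vanishes almost
everywhere. Countably many bumps are enough to reach every point. *)
Lemma ip_test_ae_eq0 g : L2 g -> (forall z, test_fun Omega z -> ip g z = 0) ->
  {ae leb2, forall x, (g \_ Omega) x = 0}.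
Proof.
move=> hg g0.
have bump0 u : test_fun Omega u -> {ae leb2, forall x, (g \_ Omega) x * u x = 0}.
  move=> tu; pose H := fun x => (g \_ Omega) x * u x.
  have uE := test_fun_patch tu.
  have iH : leb2.-integrable setT (EFin \o H).
    by have := L2_integrableM hg (test_fun_L2 tu); rewrite uE.
  have mH := measurable_int _ iH.
  apply: quadrants_ae_eq0 => //.
    by have := ip_integral hg (test_fun_L2 tu); rewrite uE g0.
  move=> a b.
  pose F (k : nat) x := (H x * quadrant_step k%:R a b x)%:E.
  have F0 k : (\int[leb2]_x F k x = 0)%E.
    have ts := test_funM (smooth_quadrant_step k%:R a b) tu.
    have := ip_integral hg (test_fun_L2 ts); rewrite (test_fun_patch ts) g0 // => h0.
    apply: etrans _ h0.
    by apply: eq_integral => x _; rewrite /F /H fctE; congr EFin; lra.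
  have ms k : measurable_fun (setT : set mR2) (quadrant_step k%:R a b).
    apply: continuous_measurable2; apply: smooth_continuous.
    exact: smooth_quadrant_step.
  have mH' : measurable_fun (setT : set mR2) H by exact/measurable_EFinP.
  have [|||||_ _] := @dominated_convergence _ _ _ leb2 setT measurableT F
    (fun x => (H x * \1_(quadrant a b) x)%:E) (fun x => `|H x|%:E).
  - by move=> k; apply/measurable_EFinP; apply: measurable_funM.
  - apply/measurable_EFinP; apply: measurable_funM => //.
    by apply: measurable_indic; exact: measurable_quadrant.
  - apply: aeW => x _; apply: cvg_EFin; first exact: nearW.
    by apply: cvgM; [exact: cvg_cst|exact: cvg_quadrant_step].
  - by have := integrable_norm iH.
  - apply: aeW => x k _; rewrite /F /= lee_fin normrM ler_piMr //.
    by have /andP[s0 s1] := quadrant_step_ge0_le1 k%:R a b x; rewrite ger0_norm.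
  under eq_fun do rewrite F0.
  move=> /cvg_lim; rewrite lim_cst // => /(_ _)/esym h.
  rewrite integral_mkcond -[RHS]h //; apply: eq_integral => x _.
  by rewrite patchE indicE; case: ifP; rewrite ?mulr1 ?mulr0.
have all0 : {ae leb2, forall x, forall n,
    match unpickle n with
    | Some i => cbox (ratbox i).1 (ratbox i).2 `<=` Omega ->
        (g \_ Omega) x * bump (ratbox i).1 (ratbox i).2 x = 0
    | None => True end}.
  apply: ae_foralln => n; case: unpickle => [i|]; last exact: aeW.
  have [iO|iO] := pselect (cbox (ratbox i : (R * R) * R).1 (ratbox i).2 `<=` Omega).
    by apply: negligibleS (bump0 _ (test_fun_bump iO)) => x /= h gx; apply: h.
  by apply: aeW => x /iO.
apply: negligibleS all0 => x /= gx h; apply: gx.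
have [xO|xO] := pselect (Omega x); last by rewrite patchE memNset.
have [i [xi iO]] := open_ratbox openO xO.
have := h (pickle i); rewrite pickleK => /(_ iO) /eqP.
by rewrite mulf_eq0 (gt_eqF (bump_gt0 xi)) orbF => /eqP.
Qed.

Lemma ip_test_eq0 g : L2 g -> (forall z, test_fun Omega z -> ip g z = 0) ->
  forall f, L2 f -> ip g f = 0.
Proof.
move=> hg g0 f hf; have ae0 := ip_test_ae_eq0 hg g0.
have iM := L2_integrableM hg hf.
apply: EFin_inj; rewrite -ip_integral //.
rewrite (@ae_eq_integral _ _ _ leb2 setT (cst 0%E)) ?integral0 //.
- exact: measurable_int iM.
- have aeE : {ae leb2, forall x, setT x ->
      ((g \_ Omega) x * (f \_ Omega) x)%:E = cst 0%E x}.
    by apply: negligibleS ae0 => x /= h gx; apply: h => _; rewrite gx mul0r.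
  exact: aeE.
Qed.

End FundamentalLemma.

(** * Weak derivatives and the Poincare inequality for test functions *)

Section WeakDerivatives.
Context {R : realType}.
Variable Omega : set (R * R).
Hypothesis openO : open Omega.
Local Notation leb2 := (@leb2 R).
Local Notation L2 := (L2 Omega).
Local Notation H1 := (H1 Omega).
Local Notation ip := (ip Omega).
Local Notation wd := (wd Omega).
Local Notation test_fun := (test_fun Omega).
Local Notation siL := (semi_inner_ip Omega).

(** Uniqueness is stated through the pairing with square integrable functions,
which is all that the energy forms can see. *)
Lemma is_weak_deriv_uniq e v g g' : is_weak_deriv Omega e v g ->
  is_weak_deriv Omega e v g' -> forall f, L2 f -> ip g f = ip g' f.
Proof.
move=> [hg gE] [hg' gE'] f hf; apply/eqP; rewrite -subr_eq0 -(si_Bl siL) //.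
apply/eqP; apply: ip_test_eq0 => //; first exact: si_sub siL _ _ _ _.
move=> z tz; rewrite (si_Bl siL) //; last exact: test_fun_L2.
by apply/eqP; rewrite subr_eq0 -eqr_opp -gE // gE'.
Qed.

Variable e : R * R.
Hypothesis he : e = e1 \/ e = e2.

Let test_fun_derive_L2 z : test_fun z -> L2 (fun x => 'D_e z x).
Proof. by move=> tz; apply: test_fun_L2; exact: test_fun_derive. Qed.

Lemma is_weak_deriv_lin k v w g g' : L2 v -> L2 w ->
  is_weak_deriv Omega e v g -> is_weak_deriv Omega e w g' ->
  is_weak_deriv Omega e (v + k *: w) (g + k *: g').
Proof.
move=> hv hw [hg gE] [hg' gE']; split; first exact: L2_closed.
move=> z tz; have tz2 := test_fun_L2 tz; have dz := test_fun_derive_L2 tz.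
by rewrite !(si_lin siL) // gE // gE' //; lra.
Qed.

Lemma H1_L2 v : H1 v -> L2 v. Proof. by case. Qed.

Lemma wdP v : H1 v -> is_weak_deriv Omega e v (wd e v).
Proof.
move=> [hv [g1 d1] [g2 d2]].
apply: (@xgetPex _ (cst 0) [set g | is_weak_deriv Omega e v g]).
by case: he => ->; [exists g1|exists g2].
Qed.

Lemma wd_L2 v : H1 v -> L2 (wd e v). Proof. by move=> /wdP[]. Qed.

Lemma ip_wd v g f : H1 v -> is_weak_deriv Omega e v g -> L2 f ->
  ip (wd e v) f = ip g f.
Proof. by move=> hv dg hf; exact: is_weak_deriv_uniq (wdP hv) dg _ hf. Qed.

(** Integration by parts: the derivative of the product of two test functions has
integral zero. *)
Lemma test_fun_weak_deriv z : test_fun z ->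
  is_weak_deriv Omega e z (fun x => 'D_e z x).
Proof.
move=> tz; split=> [|y ty]; first exact: test_fun_derive_L2.
have hz := test_fun_L2 tz; have hy := test_fun_L2 ty.
have hdz := test_fun_derive_L2 tz; have hdy := test_fun_derive_L2 ty.
have sz := test_fun_smooth tz; have sy := test_fun_smooth ty.
have tzy : test_fun (z * y) by exact: test_funM.
have := integral_partial_eq0 (test_fun_smooth tzy) (let: And3 _ c _ := tzy in c) he.
have -> : (fun x => ('D_e (z * y) x)%:E) =
    (fun x => (z x * 'D_e y x)%:E + ('D_e z x * y x)%:E)%E.
  apply/funext => x; rewrite deriveM; [|exact: smooth_derivable..].
  by rewrite -EFinD /GRing.scale /= [y x * _]mulrC.
have P1 := test_fun_patch tz; have P2 := test_fun_patch ty.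
have P3 := test_fun_patch (test_fun_derive tz he).
have P4 := test_fun_patch (test_fun_derive ty he).
have i1 := L2_integrableM hz hdy; have i2 := L2_integrableM hdz hy.
have I1 := ip_integral hz hdy; have I2 := ip_integral hdz hy.
rewrite P1 P4 in i1 I1; rewrite P3 P2 in i2 I2.
rewrite integralD // I1 I2 -EFinD => -[h].
by apply/eqP; rewrite -addr_eq0 h.
Qed.

End WeakDerivatives.

Lemma le_sqrt_sumsq (R : realType) (x y : R) : 0 <= x ->
  x <= Num.sqrt (x ^+ 2 + y ^+ 2).
Proof.
move=> x0; rewrite -[leLHS]ger0_norm // -sqrtr_sqr ler_sqrt.
  by rewrite lerDl sqr_ge0.
by rewrite addr_ge0 ?sqr_ge0.
Qed.

Section Sobolev.
Context {R : realType}.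
Variable Omega : set (R * R).
Hypothesis openO : open Omega.
Local Notation L2 := (L2 Omega).
Local Notation H1 := (H1 Omega).
Local Notation ip := (ip Omega).
Local Notation wd := (wd Omega).
Local Notation siL := (semi_inner_ip Omega).
Local Notation norm0 := (norm0 Omega).
Local Notation semi1 := (semi1 Omega).
Local Notation norm1 := (norm1 Omega).
Local Notation ipv := (ipv Omega).
Local Notation grad := (grad Omega).
Local Notation curl := (curl Omega).

Lemma test_fun_H1 z : test_fun Omega z -> H1 z.
Proof.
move=> tz; split; first exact: test_fun_L2.
  by exists (fun x => 'D_e1 z x); apply: test_fun_weak_deriv => //; left.
by exists (fun x => 'D_e2 z x); apply: test_fun_weak_deriv => //; right.
Qed.

Lemma H1_closed k v w : H1 v -> H1 w -> H1 (v + k *: w).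
Proof.
move=> [hv [g1 d1] [g2 d2]] [hw [g1' d1'] [g2' d2']].
split; first exact: L2_closed.
  by exists (g1 + k *: g1'); apply: is_weak_deriv_lin => //; left.
by exists (g2 + k *: g2'); apply: is_weak_deriv_lin => //; right.
Qed.

(** [wd] picks some weak derivative of each function, so it is additive only up to
null functions. The pairing does not see them, by uniqueness. *)
Lemma ip_wd_lin e k v w f : e = e1 \/ e = e2 -> H1 v -> H1 w -> L2 f ->
  ip (wd e (v + k *: w)) f = ip (wd e v) f + k * ip (wd e w) f.
Proof.
move=> he hv hw hf; have hvw := H1_closed k hv hw.
have wv := wdP he hv; have ww := wdP he hw.
have d := is_weak_deriv_lin he k (H1_L2 hv) (H1_L2 hw) wv ww.
rewrite (ip_wd openO he hvw d hf) (si_lin siL) //; exact: wd_L2.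
Qed.

Lemma semi_inner_wd e : e = e1 \/ e = e2 ->
  semi_inner H1 (fun v w => ip (wd e v) (wd e w)).
Proof.
move=> he; split; first exact: H1_closed.
- by move=> v w hv hw; rewrite (si_sym siL) //; exact: wd_L2.
- by move=> k v w z hv hw hz; rewrite ip_wd_lin //; exact: wd_L2.
- by move=> v hv; apply: (si_ge0 siL); exact: wd_L2.
Qed.

Lemma semi_inner_grad : semi_inner H1 (fun v w => ipv (grad v) (grad w)).
Proof. by apply: semi_innerD; apply: semi_inner_wd; [left|right]. Qed.

Lemma semi_inner_L2H1 : semi_inner H1 ip.
Proof.
split; first exact: H1_closed.
- by move=> v w /H1_L2 hv /H1_L2 hw; exact: (si_sym siL).
- by move=> k v w z /H1_L2 hv /H1_L2 hw /H1_L2 hz; exact: (si_lin siL).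
- by move=> v /H1_L2 hv; exact: (si_ge0 siL).
Qed.

Lemma semi_inner_H1 : semi_inner H1 (fun v w => ip v w + ipv (grad v) (grad w)).
Proof. exact: semi_innerD semi_inner_L2H1 semi_inner_grad. Qed.

Lemma norm1E v : H1 v ->
  norm1 v = si_norm (fun v w => ip v w + ipv (grad v) (grad w)) v.
Proof.
move=> hv; rewrite /norm1 /norm0 /semi1 !sqr_sqrtr //.
  exact: (si_ge0 semi_inner_grad).
exact: (si_ge0 semi_inner_L2H1).
Qed.

Lemma curl_curlE v w :
  ipv (curl v) (curl w) = ipv (grad v) (grad w).
Proof.
rewrite /ipv.
have fc u : fst \o curl u = snd \o grad u by apply/funext.
have sc : ip (snd \o curl v) (snd \o curl w) = ip (fst \o grad v) (fst \o grad w).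
  by rewrite /ip; congr (Rintegral _ _ _); apply/funext => x /=; rewrite mulrNN.
rewrite (fc v) (fc w) sc.
exact (addrC (ip (snd \o grad v) (snd \o grad w)) (ip (fst \o grad v) (fst \o grad w))).
Qed.

Lemma norm0_sqr v : L2 v -> norm0 v ^+ 2 = ip v v.
Proof. exact: (si_normE siL). Qed.

Lemma norm0_le_norm1 v : norm0 v <= norm1 v.
Proof. exact: le_sqrt_sumsq (sqrtr_ge0 _). Qed.

Lemma semi1_le_norm1 v : semi1 v <= norm1 v.
Proof. by rewrite /norm1 addrC; exact: le_sqrt_sumsq (sqrtr_ge0 _). Qed.

Lemma norm0_wd1_le v : H1 v -> norm0 (wd e1 v) <= semi1 v.
Proof.
move=> hv; rewrite ler_sqrt; last exact: (si_ge0 semi_inner_grad hv).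
by rewrite lerDl; apply: (si_ge0 (semi_inner_wd (or_intror erefl)) hv).
Qed.

Lemma norm0_wd2_le v : H1 v -> norm0 (wd e2 v) <= semi1 v.
Proof.
move=> hv; rewrite ler_sqrt; last exact: (si_ge0 semi_inner_grad hv).
by rewrite lerDr; apply: (si_ge0 (semi_inner_wd (or_introl erefl)) hv).
Qed.

(** Testing the weak derivative of [z] against [x1 z], where [x1] is the first
coordinate, gives [ip z z = - 2 ip (D1 z) (x1 z)]; Cauchy-Schwarz and
[|x1| <= M] conclude. *)
Lemma poincare_test (M : R) z : 0 <= M -> (forall x, Omega x -> `|x.1| <= M) ->
  test_fun Omega z -> norm0 z <= 2 * M * semi1 z.
Proof.
move=> M0 OM tz; have hz := test_fun_L2 tz; have h1z := test_fun_H1 tz.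
have he1 : (e1 : R * R) = e1 \/ (e1 : R * R) = e2 by left.
have tDz := test_fun_derive tz he1; have hDz := test_fun_L2 tDz.
pose X := affine 1 0 0 : R * R -> R.
have sX : smooth X by exact: smooth_affine.
have tXz := test_funM sX tz; have hXz := test_fun_L2 tXz.
have tXXz := test_funM sX tXz; have hXXz := test_fun_L2 tXXz.
have hXDz := test_fun_L2 (test_funM sX tDz).
have XE x : X x = x.1 by rewrite /X /affine; lra.
have [_ /(_ _ tXz)] := test_fun_weak_deriv he1 tz.
have -> : (fun x => 'D_e1 (X * z) x) = z + X * (fun x => 'D_e1 z x).
  apply/funext => x; rewrite deriveM; [|exact: smooth_derivable..|].
    rewrite -[X]/(id \o affine 1 0 0) derive_comp_affine derive_id.
    by rewrite /e1 /= !fctE /GRing.scale /=; lra.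
  exact: smooth_derivable (test_fun_smooth tz) he1.
rewrite (si_sym siL hz) ?(si_Dl siL) //; last exact: (si_add siL).
have -> : ip (X * (fun x => 'D_e1 z x)) z = ip (fun x => 'D_e1 z x) (X * z).
  by rewrite /ip; congr (Rintegral _ _ _); apply/funext => x; rewrite !fctE; lra.
set s := ip _ (X * z) => zz.
have sE : `|s| <= norm0 (wd e1 z) * norm0 (X * z).
  rewrite /s -(ip_wd openO he1 h1z (test_fun_weak_deriv he1 tz) hXz).
  exact: (si_CS siL (wd_L2 he1 h1z) hXz).
(* The product with [x1] is estimated pointwise: [(M ^ 2 - x1 ^ 2) z ^ 2 >= 0]. *)
have XzM : norm0 (X * z) <= M * norm0 z.
  rewrite -ler_sqr ?nnegrE ?mulr_ge0 ?sqrtr_ge0 // exprMn !norm0_sqr //.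
  have -> : ip (X * z) (X * z) = ip (X * (X * z)) z.
    by rewrite /ip; congr (Rintegral _ _ _); apply/funext => x; rewrite !fctE; lra.
  have ha : L2 (z + (M ^+ 2 - 1) *: z) by exact: L2_closed.
  have : 0 <= ip (z + (M ^+ 2 - 1) *: z - X * (X * z)) z.
    apply: Rintegral_ge0 => x Ox; rewrite !fctE /GRing.scale /= XE.
    have xM : x.1 ^+ 2 <= M ^+ 2.
      by rewrite -(real_normK (num_real x.1)) ler_sqr ?nnegrE // OM.
    have -> : (z x + (M ^+ 2 - 1) * z x - x.1 * (x.1 * z x)) * z x =
      (M ^+ 2 - x.1 ^+ 2) * z x ^+ 2 by lra.
    by rewrite mulr_ge0 ?sqr_ge0 // subr_ge0.
  by rewrite (si_Bl siL) // (si_lin siL) //; lra.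
have n0 : 0 <= norm0 z by exact: sqrtr_ge0.
have d0 := norm0_wd1_le h1z; have dge := sqrtr_ge0 (ip (wd e1 z) (wd e1 z)).
have [->|zN0] := eqVneq (norm0 z) 0; first by rewrite !mulr_ge0 // sqrtr_ge0.
have zgt0 : 0 < norm0 z by rewrite lt_def zN0.
rewrite -(ler_pM2r zgt0) -expr2 norm0_sqr //.
have s1 : `|s| <= semi1 z * (M * norm0 z).
  by apply: le_trans sE _; apply: ler_pM => //; exact: sqrtr_ge0.
by have := ler_norm (- s); rewrite normrN; lra.
Qed.

End Sobolev.

(** * Galerkin estimates and the coupled spaces *)

Section AbstractGalerkin.
Context {R : realType}.

(** Dividing by the norm; a vanishing norm satisfies the bound trivially. *)
Lemma si_norm_le (E : lmodType R) (D : set E) B (z : E) (c : R) :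
  semi_inner D B -> D z -> B z z <= c * si_norm B z -> 0 <= c -> si_norm B z <= c.
Proof.
move=> h Dz; rewrite -(si_normE h Dz) expr2 => le c0.
have [->//|zN0] := eqVneq (si_norm B z) 0.
by rewrite -(ler_pM2r (_ : 0 < si_norm B z)) // lt_def zN0 si_norm_ge0.
Qed.

(** Cea's lemma with a consistency error [c]: the discrete difference [xh - y] is
measured by testing with itself, where the residual costs [c]. *)
Lemma cea (E : lmodType R) (D S : set E) B (x xh y : E) (c : R) :
  semi_inner D B -> S `<=` D -> (forall s t, S s -> S t -> S (s - t)) ->
  D x -> S xh -> S y -> 0 <= c ->
  (forall s, S s -> `|B (x - xh) s| <= c * si_norm B s) ->
  si_norm B (x - xh) <= 2 * si_norm B (x - y) + c.
Proof.
move=> h SD Ssub Dx Sxh Sy c0 res.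
have Dxh := SD _ Sxh; have Dy := SD _ Sy.
have Se := Ssub _ _ Sxh Sy; have De := SD _ Se.
have Dxy := si_sub h Dx Dy; have Dxxh := si_sub h Dx Dxh.
have e_le : si_norm B (xh - y) <= si_norm B (x - y) + c.
  apply: (si_norm_le h De); last by rewrite addr_ge0 // si_norm_ge0.
  have -> : B (xh - y) (xh - y) = B (x - y) (xh - y) - B (x - xh) (xh - y).
    by rewrite (si_Bl h Dxh Dy De) (si_Bl h Dx Dy De) (si_Bl h Dx Dxh De); lra.
  have := le_trans (ler_norm _) (si_CS h Dxy De).
  have := res _ Se; rewrite ler_norml => /andP[+ _].
  by lra.
have := si_triangleB h Dx Dy Dxh.
by rewrite (si_normBC h Dy Dxh); lra.
Qed.

Variables (E F : lmodType R) (D S : set E) (L Q : set F).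
Variables (A : E -> E -> R) (m : F -> F -> R) (b : E -> F -> R).
Hypotheses (hA : semi_inner D A) (hm : semi_inner L m).
Hypotheses (SD : S `<=` D) (QL : Q `<=` L).
Hypotheses (Ssub : forall s t, S s -> S t -> S (s - t))
           (Qsub : forall s t, Q s -> Q t -> Q (s - t)).
Hypotheses (bBl : forall x y q, D x -> D y -> L q -> b (x - y) q = b x q - b y q)
           (bBr : forall x p q, D x -> L p -> L q -> b x (p - q) = b x p - b x q).
Variables (g beta : R).
Hypotheses (g0 : 0 <= g) (beta0 : 0 <= beta).
Hypothesis b_le : forall x q, D x -> L q -> `|b x q| <= g * si_norm A x * si_norm m q.
Hypothesis infsup : forall q c, Q q -> 0 <= c ->
  (forall s, S s -> `|b s q| <= c * si_norm A s) -> si_norm m q <= beta * c.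

(** Brezzi's estimate with residual [r]. The multiplier error is bounded through
the inf-sup condition by the primal error, and the coupling term [b e t] in the
energy of the primal error [e] involves only the consistent part [x - y]. *)
Lemma saddle_estimate (x xh y : E) (p ph q : F) (r : R) :
  D x -> S xh -> S y -> L p -> Q ph -> Q q -> 0 <= r ->
  (forall s, S s -> `|A (x - xh) s + b s (p - ph)| <= r * si_norm A s) ->
  (forall t, Q t -> b (x - xh) t = 0) ->
  let a := si_norm A (x - y) + g * si_norm m (p - q) + r in
  si_norm A (xh - y) <= (1 + 2 * g * beta) * a /\
  si_norm m (ph - q) <= beta * (2 + 2 * g * beta) * a.
Proof.
move=> Dx Sxh Sy Lp Qph Qq r0 res cons a.
have Dxh := SD Sxh; have Dy := SD Sy; have Lph := QL Qph; have Lq := QL Qq.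
have Se := Ssub Sxh Sy; have De := SD Se; have Dxy := si_sub hA Dx Dy.
have Dxxh := si_sub hA Dx Dxh.
have Qt := Qsub Qph Qq; have Lt := QL Qt; have Lpq := si_sub hm Lp Lq.
have Lpph := si_sub hm Lp Lph.
have nx0 := si_norm_ge0 A (x - y); have np0 := si_norm_ge0 m (p - q).
have a0 : 0 <= a by rewrite /a !addr_ge0 // mulr_ge0.
have e0 := si_norm_ge0 A (xh - y); have t0 := si_norm_ge0 m (ph - q).
have key s : S s -> `|A (xh - y) s + b s (ph - q)| <= a * si_norm A s.
  move=> Ss; have Ds := SD Ss.
  have -> : A (xh - y) s + b s (ph - q) =
     A (x - y) s + b s (p - q) - (A (x - xh) s + b s (p - ph)).
    by rewrite !(si_Bl hA) // !bBr //; lra.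
  apply: le_trans (ler_normB _ _) _.
  apply: le_trans (lerD (ler_normD _ _) (res _ Ss)) _.
  have := lerD (si_CS hA Dxy Ds) (b_le Ds Lpq); rewrite /a; lra.
have t_le : si_norm m (ph - q) <= beta * (a + si_norm A (xh - y)).
  apply: infsup => //; first by rewrite addr_ge0.
  move=> s Ss; have Ds := SD Ss.
  have -> : b s (ph - q) = A (xh - y) s + b s (ph - q) - A (xh - y) s by lra.
  apply: le_trans (ler_normB _ _) _; rewrite mulrDl.
  by apply: lerD; [exact: key|exact: (si_CS hA De Ds)].
have bet : b (xh - y) (ph - q) = b (x - y) (ph - q).
  by have := cons _ Qt; rewrite !bBl //; lra.
have e_le : si_norm A (xh - y) <= (1 + 2 * g * beta) * a.
  set e := si_norm A (xh - y) in e0 t_le *; set t := si_norm m (ph - q) in t0 t_le.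
  (* The quadratic inequality for [e]; beyond the claimed bound, [a <= e] makes
     its right-hand side smaller than [e ^ 2]. *)
  have ee : e ^+ 2 <= a * e + g * a * (beta * (a + e)).
    rewrite (si_normE hA De).
    have k1 := le_trans (ler_norm _) (key _ Se).
    have : `|b (xh - y) (ph - q)| <= g * a * (beta * (a + e)).
      rewrite bet; apply: le_trans (b_le Dxy Lt) _; rewrite -/t.
      apply: ler_pM => //; first by rewrite mulr_ge0.
      by rewrite ler_wpM2l // /a -addrA lerDl addr_ge0 // mulr_ge0.
    by rewrite ler_norml => /andP[+ _]; rewrite -/e in k1; lra.
  rewrite leNgt; apply/negP => lt_e.
  have gb0 : 0 <= g * beta by rewrite mulr_ge0.
  have gba0 : 0 <= g * beta * a by rewrite mulr_ge0.
  have ae : a <= e by lra.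
  have h1 : g * beta * a * a <= g * beta * a * e by rewrite ler_wpM2l.
  have epos : 0 < e by lra.
  have : (1 + 2 * g * beta) * a * e < e * e by rewrite ltr_pM2r.
  by lra.
split=> //; apply: le_trans t_le _.
have := ler_wpM2l beta0 e_le; lra.
Qed.

End AbstractGalerkin.

Section VectorFields.
Context {R : realType}.
Variable Omega : set (R * R).
Hypothesis openO : open Omega.
(* Comparing two pairings must not unfold them into Lebesgue integrals. *)
Opaque Defs.ip Defs.wd.
Local Notation L2 := (L2 Omega).
Local Notation H1 := (H1 Omega).
Local Notation H10 := (H10 Omega).
Local Notation H10v := (H10v Omega).
Local Notation ip := (ip Omega).
Local Notation wd := (wd Omega).
Local Notation siL := (semi_inner_ip Omega).
Local Notation norm0 := (norm0 Omega).
Local Notation semi1 := (semi1 Omega).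
Local Notation norm1 := (norm1 Omega).
Local Notation norm0v := (norm0v Omega).
Local Notation semi1v := (semi1v Omega).
Local Notation norm1v := (norm1v Omega).
Local Notation ipv := (ipv Omega).
Local Notation ip_grad := (ip_grad Omega).
Local Notation grad := (grad Omega).
Local Notation curl := (curl Omega).
Local Notation div := (div Omega).

Lemma H10_H1 v : H10 v -> H1 v. Proof. by case. Qed.

(** The test functions form a vector space, and [norm1] is a seminorm. *)
Lemma H10_sub v w : H10 v -> H10 w -> H10 (v - w).
Proof.
move=> [hv av] [hw aw]; have hN := semi_inner_H1 openO.
split=> [|eps eps0]; first exact: (si_sub hN).
have e20 : 0 < eps / 2 by rewrite divr_gt0.
have [z tz vz] := av _ e20; have [y ty wy] := aw _ e20.
have hz := test_fun_H1 tz; have hy := test_fun_H1 ty.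
exists (z - y); first by rewrite -scaleN1r; exact: test_fun_closed.
have hvz := si_sub hN hv hz; have hwy := si_sub hN hw hy.
have h0 : H1 0 by rewrite -(subrr v); exact: (si_sub hN).
pose N := si_norm (fun v w => ip v w + ipv (grad v) (grad w)).
have NE u : H1 u -> norm1 u = N u := @norm1E _ _ openO u.
have t1 : N ((v - z) - (w - y)) <= N ((v - z) - 0) + N (0 - (w - y)) :=
  si_triangleB hN hvz h0 hwy.
have t2 : N (0 - (w - y)) = N ((w - y) - 0) := si_normBC hN h0 hwy.
have hvwzy := si_sub hN hvz hwy.
rewrite t2 !subr0 in t1; clearbody N.
have -> : v - w - (z - y) = (v - z) - (w - y) by rewrite !opprD !opprK addrACA.
rewrite (NE _ hvwzy); rewrite (NE _ hvz) in vz; rewrite (NE _ hwy) in wy.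
by apply: le_lt_trans t1 _; lra.
Qed.

(** The arithmetic of the density argument: [nd], [sd], [a] stand for the norms of
the difference between [v] and an approximating test function. *)
Let poincare_limit (M eps a n nd nz sz sd sv : R) : 0 <= M -> 0 < 1 + 2 * M ->
  a < eps / (1 + 2 * M) -> nd <= a -> sd <= a -> n <= nd + nz ->
  sz <= sd + sv -> nz <= 2 * M * sz -> n <= eps + 2 * M * sv.
Proof.
move=> M0 M10; rewrite ltr_pdivlMr // => ha hnd hsd hn hsz hnz.
have : 2 * M * sz <= 2 * M * (a + sv).
  by rewrite ler_wpM2l ?mulr_ge0 // (le_trans hsz) // lerD2r.
by lra.
Qed.

(** Both sides are continuous for [norm1], and test functions are dense in [H10]. *)
Lemma poincare (M : R) v : 0 <= M -> (forall x, Omega x -> `|x.1| <= M) ->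
  H10 v -> norm0 v <= 2 * M * semi1 v.
Proof.
move=> M0 OM [hv av]; apply/ler_addgt0Pl => eps eps0.
have M10 : 0 < 1 + 2 * M by lra.
have [z tz vz] := av _ (divr_gt0 eps0 M10).
have hz := test_fun_H1 tz; have hvz := si_sub (semi_inner_H1 openO) hv hz.
have p := poincare_test openO M0 OM tz.
have n1 := norm0_le_norm1 Omega (v - z).
have s1 := semi1_le_norm1 Omega (v - z).
have siG := semi_inner_grad openO.
have t0 : norm0 (v - z + z) <= norm0 (v - z) + norm0 z :=
  si_triangle siL (H1_L2 hvz) (H1_L2 hz).
have t1 : semi1 (z - v + v) <= semi1 (z - v) + semi1 v :=
  si_triangle siG (si_sub siG hz hv) hv.
have t2 : semi1 (z - v) = semi1 (v - z) := si_normBC siG hz hv.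
rewrite subrK in t0; rewrite subrK t2 in t1.
exact: (poincare_limit M0 M10 vz n1 s1 t0 t1 p).
Qed.

Definition L2v : set (R * R -> R * R) :=
  [set F | L2 (fst \o F) /\ L2 (snd \o F)].
Definition H1v : set (R * R -> R * R) :=
  [set F | H1 (fst \o F) /\ H1 (snd \o F)].

Let fst_lin k (F G : R * R -> R * R) :
  fst \o (F + k *: G) = (fst \o F) + k *: (fst \o G). Proof. exact/funext. Qed.
Let snd_lin k (F G : R * R -> R * R) :
  snd \o (F + k *: G) = (snd \o F) + k *: (snd \o G). Proof. exact/funext. Qed.

Let fst_sub (F G : R * R -> R * R) :
  fst \o (F - G) = (fst \o F) + (-1) *: (fst \o G).
Proof. by rewrite -fst_lin scaleN1r. Qed.
Let snd_sub (F G : R * R -> R * R) :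
  snd \o (F - G) = (snd \o F) + (-1) *: (snd \o G).
Proof. by rewrite -snd_lin scaleN1r. Qed.

Lemma semi_inner_ipv : semi_inner L2v ipv.
Proof.
have cl k F G : L2v F -> L2v G -> L2v (F + k *: G).
  by move=> [F1 F2] [G1 G2]; split; rewrite ?fst_lin ?snd_lin; exact: L2_closed.
apply: semi_innerD.
- apply: (@semi_inner_comp _ _ _ (fun F : R * R -> R * R => fst \o F)
    _ _ _ _ cl _ siL) => //.
  by move=> F [].
- apply: (@semi_inner_comp _ _ _ (fun F : R * R -> R * R => snd \o F)
    _ _ _ _ cl _ siL) => //.
  by move=> F [].
Qed.

Lemma H1v_closed k F G : H1v F -> H1v G -> H1v (F + k *: G).
Proof.
by move=> [F1 F2] [G1 G2]; split; rewrite ?fst_lin ?snd_lin; exact: H1_closed.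
Qed.

Lemma semi_inner_ip_grad : semi_inner H1v ip_grad.
Proof.
have siG := semi_inner_grad openO.
apply: semi_innerD.
- apply: (@semi_inner_comp _ _ _ (fun F : R * R -> R * R => fst \o F)
    _ _ _ _ H1v_closed _ siG) => //.
  by move=> F [].
- apply: (@semi_inner_comp _ _ _ (fun F : R * R -> R * R => snd \o F)
    _ _ _ _ H1v_closed _ siG) => //.
  by move=> F [].
Qed.

Lemma H1v_L2v F : H1v F -> L2v F.
Proof. by move=> [/H1_L2 F1 /H1_L2 F2]. Qed.

Lemma H10v_H1v F : H10v F -> H1v F.
Proof. by move=> [/H10_H1 F1 /H10_H1 F2]. Qed.

Lemma H10v_sub F G : H10v F -> H10v G -> H10v (F - G).
Proof.
move=> [F1 F2] [G1 G2]; rewrite -scaleN1r; split; rewrite ?fst_lin ?snd_lin scaleN1r;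
  exact: H10_sub.
Qed.

Lemma semi1_fst_le F : H1v F -> semi1 (fst \o F) <= semi1v F.
Proof.
move=> hF; have [F1 F2] := hF.
rewrite ler_sqrt; last exact: (si_ge0 semi_inner_ip_grad hF).
by rewrite lerDl; exact: (si_ge0 (semi_inner_grad openO) F2).
Qed.

Lemma semi1_snd_le F : H1v F -> semi1 (snd \o F) <= semi1v F.
Proof.
move=> hF; have [F1 F2] := hF.
rewrite ler_sqrt; last exact: (si_ge0 semi_inner_ip_grad hF).
by rewrite lerDr; exact: (si_ge0 (semi_inner_grad openO) F1).
Qed.

Lemma norm0v_sqr F : L2v F ->
  norm0v F ^+ 2 = norm0 (fst \o F) ^+ 2 + norm0 (snd \o F) ^+ 2.
Proof.
move=> hF; have [F1 F2] := hF.
have h : norm0v F ^+ 2 = ipv F F := si_normE semi_inner_ipv hF.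
exact: (etrans h (esym (f_equal2 +%R (norm0_sqr F1) (norm0_sqr F2)))).
Qed.

Lemma semi1v_sqr F : H1v F ->
  semi1v F ^+ 2 = semi1 (fst \o F) ^+ 2 + semi1 (snd \o F) ^+ 2.
Proof.
move=> hF; have [F1 F2] := hF; have siG := semi_inner_grad openO.
have h : semi1v F ^+ 2 = ip_grad F F := si_normE semi_inner_ip_grad hF.
exact: (etrans h (esym (f_equal2 +%R (si_normE siG F1) (si_normE siG F2)))).
Qed.

Lemma poincarev (M : R) F : 0 <= M -> (forall x, Omega x -> `|x.1| <= M) ->
  H10v F -> norm0v F <= 2 * M * semi1v F.
Proof.
move=> M0 OM hF; have h1F := H10v_H1v hF; have [F1 F2] := hF; have [G1 G2] := h1F.
have K0 : 0 <= 2 * M by rewrite mulr_ge0.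
have n0 : 0 <= norm0v F by exact: sqrtr_ge0.
have s0 : 0 <= 2 * M * semi1v F by rewrite mulr_ge0 // sqrtr_ge0.
rewrite -(ler_sqr n0 s0) exprMn.
rewrite (norm0v_sqr (H1v_L2v h1F)) (semi1v_sqr h1F).
have sq (u : R * R -> R) : H10 u -> norm0 u ^+ 2 <= (2 * M) ^+ 2 * semi1 u ^+ 2.
  move=> hu; rewrite -exprMn ler_sqr ?nnegrE ?mulr_ge0 ?sqrtr_ge0 //.
  exact: poincare.
by rewrite mulrDr lerD // sq.
Qed.

Lemma sqrt_sum_le (x y K : R) : 0 <= y -> 0 <= K -> 0 <= x -> x <= K * y ->
  Num.sqrt (x ^+ 2 + y ^+ 2) <= (1 + K) * y.
Proof.
move=> y0 K0 x0 xy; have Ky : 0 <= (1 + K) * y by rewrite mulr_ge0 // addr_ge0.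
rewrite -[leRHS]ger0_norm // -sqrtr_sqr ler_sqrt ?sqr_ge0 //.
have : x ^+ 2 <= (K * y) ^+ 2 by rewrite ler_sqr ?nnegrE // mulr_ge0.
have : 0 <= K * y ^+ 2 by rewrite mulr_ge0 // sqr_ge0.
by rewrite !exprMn; lra.
Qed.

Lemma norm0v_le_norm1v F : norm0v F <= norm1v F.
Proof. exact: le_sqrt_sumsq (sqrtr_ge0 _). Qed.

Lemma semi1v_le_norm1v F : semi1v F <= norm1v F.
Proof. by rewrite /norm1v addrC; exact: le_sqrt_sumsq (sqrtr_ge0 _). Qed.

Lemma ip_divE F q : H1v F -> L2 q ->
  ip (div F) q = ip (wd e1 (fst \o F)) q + ip (wd e2 (snd \o F)) q.
Proof.
move=> [F1 F2] hq; rewrite -(si_Dl siL) //.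
  exact: (wd_L2 (or_introl erefl) F1).
exact: (wd_L2 (or_intror erefl) F2).
Qed.

Lemma L2_div F : H1v F -> L2 (div F).
Proof.
move=> [F1 F2]; apply: (si_add siL).
  exact: (wd_L2 (or_introl erefl) F1).
exact: (wd_L2 (or_intror erefl) F2).
Qed.

Let sub_split (x y z a a1 a2 b b1 b2 : R) : x = a + b ->
  a = a1 + -1 * a2 -> b = b1 + -1 * b2 -> y = a1 + b1 -> z = a2 + b2 -> x = y - z.
Proof. by move=> -> -> -> -> ->; lra. Qed.

Lemma ip_divB F G q : H1v F -> H1v G -> L2 q ->
  ip (div (F - G)) q = ip (div F) q - ip (div G) q.
Proof.
move=> hF hG hq; have hFG := si_sub semi_inner_ip_grad hF hG.
have [F1 F2] := hF; have [G1 G2] := hG.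
have E0 := ip_divE hFG hq; rewrite fst_sub snd_sub in E0.
exact: (sub_split E0 (ip_wd_lin openO (-1) (or_introl erefl) F1 G1 hq)
  (ip_wd_lin openO (-1) (or_intror erefl) F2 G2 hq) (ip_divE hF hq) (ip_divE hG hq)).
Qed.

Lemma ip_div_le F q : H1v F -> L2 q -> `|ip (div F) q| <= 2 * semi1v F * norm0 q.
Proof.
move=> hF hq; have [F1 F2] := hF; rewrite (ip_divE hF hq).
have q0 : 0 <= norm0 q by exact: sqrtr_ge0.
have k1 := si_CS siL (wd_L2 (or_introl erefl) F1) hq.
have k2 := si_CS siL (wd_L2 (or_intror erefl) F2) hq.
have l1 := le_trans (norm0_wd1_le openO F1) (semi1_fst_le hF).
have l2 := le_trans (norm0_wd2_le openO F2) (semi1_snd_le hF).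
have m1 := ler_wpM2r q0 l1; have m2 := ler_wpM2r q0 l2.
apply: le_trans (ler_normD _ _) _.
apply: le_trans (lerD (le_trans k1 m1) (le_trans k2 m2)) _.
by rewrite -mulrA mulr_natl mulr2n.
Qed.

Lemma L2v_curl v : H1 v -> L2v (curl v).
Proof.
move=> hv; split; first exact: (wd_L2 (or_intror erefl) hv).
(* [- x] written as [x + (- 2) x], the form in which linearity is available. *)
have -> : snd \o curl v = (wd e1 v + (-2) *: wd e1 v).
  by apply/funext => x; rewrite !fctE /GRing.scale /=; lra.
by apply: L2_closed; exact: (wd_L2 (or_introl erefl) hv).
Qed.

Lemma ipv_curlE v F : H1 v -> L2v F ->
  ipv (curl v) F = ip (wd e2 v) (fst \o F) - ip (wd e1 v) (snd \o F).
Proof.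
move=> hv [F1 F2]; congr (_ + _).
have hd := wd_L2 (or_introl erefl) hv.
have -> : snd \o curl v = (wd e1 v + (-2) *: wd e1 v).
  by apply/funext => x; rewrite !fctE /GRing.scale /=; lra.
by rewrite (si_lin siL) //; lra.
Qed.

Let curl_split (x y z a a1 a2 b b1 b2 : R) : x = a - b ->
  a = a1 + -1 * a2 -> b = b1 + -1 * b2 -> y = a1 - b1 -> z = a2 - b2 -> x = y - z.
Proof. by move=> -> -> -> -> ->; lra. Qed.

Lemma ipv_curlB v w F : H1 v -> H1 w -> L2v F ->
  ipv (curl (v - w)) F = ipv (curl v) F - ipv (curl w) F.
Proof.
move=> hv hw hF; have hvw := si_sub (semi_inner_grad openO) hv hw.
have [F1 F2] := hF.
have vwE : v - w = v + (-1) *: w by rewrite scaleN1r.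
rewrite vwE in hvw *; have E0 := ipv_curlE hvw hF.
exact: (curl_split E0 (ip_wd_lin openO (-1) (or_intror erefl) hv hw F1)
  (ip_wd_lin openO (-1) (or_introl erefl) hv hw F2)
  (ipv_curlE hv hF) (ipv_curlE hw hF)).
Qed.

Lemma norm0v_curl v : norm0v (curl v) = semi1 v.
Proof. by rewrite /norm0v (curl_curlE Omega v v). Qed.

Lemma ipv_curl_le v F : H1 v -> L2v F -> `|ipv F (curl v)| <= norm0v F * semi1 v.
Proof.
move=> hv hF; have := si_CS semi_inner_ipv hF (L2v_curl hv).
by rewrite -(norm0v_curl v).
Qed.

End VectorFields.

(** * Errors of the decoupled discretization *)

Section Auxiliary.
Context {R : realType}.

Lemma finite_dim_sub (E : lmodType R) (V : set E) : finite_dim V ->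
  forall v w, V v -> V w -> V (v - w).
Proof.
move=> [n [b ->]] _ _ [c ->] [d ->]; exists (fun i => c i - d i).
by rewrite -sumrB; apply: eq_bigr => i _; rewrite scalerBl.
Qed.

(** [l / C - t] is a lower bound of the image. *)
Lemma le_inf_image (T : Type) (S : set T) (d : T -> R) (l C t : R) : 0 < C ->
  S !=set0 -> (forall s, S s -> l <= C * (d s + t)) ->
  l <= C * (inf [set d s | s in S] + t).
Proof.
move=> C0 [s0 Ss0] h; rewrite mulrC -ler_pdivrMr // -lerBlDr.
apply: lb_le_inf; first by exists (d s0); exists s0.
by move=> _ [s Ss <-]; rewrite lerBlDr ler_pdivrMr // mulrC h.
Qed.

Lemma le_inf_image3 (T1 T2 T3 : Type) (S1 : set T1) (S2 : set T2) (S3 : set T3)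
    (d1 : T1 -> R) (d2 : T2 -> R) (d3 : T3 -> R) (l C t : R) : 0 < C ->
  S1 !=set0 -> S2 !=set0 -> S3 !=set0 ->
  (forall s1 s2 s3, S1 s1 -> S2 s2 -> S3 s3 ->
    l <= C * (d1 s1 + d2 s2 + d3 s3 + t)) ->
  l <= C * (inf [set d1 s | s in S1] + inf [set d2 s | s in S2] +
            inf [set d3 s | s in S3] + t).
Proof.
move=> C0 n1 n2 n3 h; rewrite -!addrA; apply: le_inf_image => // s1 Ss1.
rewrite [X in C * X]addrCA; apply: le_inf_image => // s2 Ss2.
rewrite [d1 s1 + _]addrCA [X in C * X]addrCA; apply: le_inf_image => // s3 Ss3.
by apply: le_trans (h _ _ _ Ss1 Ss2 Ss3) _; rewrite ler_pM2l //; lra.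
Qed.

Lemma inf_image_ge0 (T : Type) (S : set T) (d : T -> R) :
  S !=set0 -> (forall s, 0 <= d s) -> 0 <= inf [set d s | s in S].
Proof.
move=> [s0 Ss0] d0; apply: lb_le_inf; first by exists (d s0); exists s0.
by move=> _ [s _ <-].
Qed.

Lemma bounded_abscissa (Omega : set (R * R)) : bounded_set Omega ->
  exists2 M : R, 0 <= M & forall x, Omega x -> `|x.1| <= M.
Proof.
move=> [M0 [_ hM]]; exists (`|M0| + 1); first by rewrite addr_ge0.
move=> x Ox; have M0M : M0 < `|M0| + 1 by rewrite (le_lt_trans (ler_norm _)) // ltrDl.
have /= := hM _ M0M x Ox; rewrite prod_normE ge_max => /andP[+ _]; exact.
Qed.

End Auxiliary.

Section DiscreteErrors.
Context {R : realType}.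
Variable Omega : set (R * R).
Hypothesis openO : open Omega.
Local Notation L2 := (L2 Omega).
Local Notation H1 := (H1 Omega).
Local Notation H10 := (H10 Omega).
Local Notation H10v := (H10v Omega).
Local Notation ip := (ip Omega).
Local Notation norm0 := (norm0 Omega).
Local Notation semi1 := (semi1 Omega).
Local Notation norm1 := (norm1 Omega).
Local Notation norm0v := (norm0v Omega).
Local Notation semi1v := (semi1v Omega).
Local Notation norm1v := (norm1v Omega).
Local Notation ipv := (ipv Omega).
Local Notation ip_grad := (ip_grad Omega).
Local Notation grad := (grad Omega).
Local Notation curl := (curl Omega).
Local Notation div := (div Omega).
(* As above, pairings are not to be unfolded during unification. *)
Opaque Defs.ip Defs.wd.

(** The form in which the inf-sup condition is used. When no admissible field has
a nonzero seminorm, the supremum is taken over the empty set and is [0]. *)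
Lemma inf_sup_dual (C : R) X P q c : 0 < C -> inf_sup Omega C X P ->
  P q -> 0 <= c -> (forall s, X s -> `|ip (div s) q| <= c * semi1v s) ->
  norm0 q <= C * c.
Proof.
move=> C0 hC Pq c0 hc; apply: le_trans (hC q Pq) _; rewrite ler_pM2l //.
set S := [set _ | _ in _]; have [->|/set0P S0] := eqVneq S set0.
  by rewrite sup0.
apply: ge_sup => // _ [s [Xs sN0] <-].
have s0 : 0 < semi1v s by rewrite lt_def sN0 sqrtr_ge0.
by rewrite ler_pdivrMr // (le_trans (ler_norm _)) // hc.
Qed.

Variable K : R.
Hypothesis K0 : 0 <= K.
Hypothesis poinc : forall v, H10 v -> norm0 v <= K * semi1 v.
Hypothesis poincv : forall F, H10v F -> norm0v F <= K * semi1v F.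

Lemma norm1_le_semi1 v : H10 v -> norm1 v <= (1 + K) * semi1 v.
Proof.
by move=> hv; exact: (sqrt_sum_le (sqrtr_ge0 _) K0 (sqrtr_ge0 _) (poinc hv)).
Qed.

Lemma norm1v_le_semi1v F : H10v F -> norm1v F <= (1 + K) * semi1v F.
Proof.
by move=> hF; exact: (sqrt_sum_le (sqrtr_ge0 _) K0 (sqrtr_ge0 _) (poincv hF)).
Qed.

Variables (V : set (R * R -> R)) (X : set (R * R -> R * R)) (P : set (R * R -> R)).
Hypotheses (VH : V `<=` H10) (XH : X `<=` H10v) (PL : P `<=` L2).
Hypotheses (Vsub : forall s t, V s -> V t -> V (s - t))
           (Xsub : forall s t, X s -> X t -> X (s - t))
           (Psub : forall s t, P s -> P t -> P (s - t)).
Variable beta : R.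
Hypothesis beta0 : 0 < beta.
Hypothesis infsup : inf_sup Omega beta X P.

Let VH1 : V `<=` H1. Proof. by move=> v /VH/H10_H1. Qed.
Let XH1 : X `<=` H1v Omega. Proof. by move=> v /XH/H10v_H1v. Qed.

Variables (f w : R * R -> R) (phi : R * R -> R * R) (p u : R * R -> R).
Hypotheses (hw : H10 w) (hphi : H10v phi) (hp : L2 p) (hu : H10 u).
Hypothesis eqs : decoupled_equations Omega V X P f w phi p u.
Variables (wh : R * R -> R) (phih : R * R -> R * R) (ph uh : R * R -> R).
Hypothesis sol : decoupled_solution Omega V X P f wh phih ph uh.

Let hw1 : H1 w := H10_H1 hw.
Let hu1 : H1 u := H10_H1 hu.
Let hphi1 : H1v Omega phi := H10v_H1v hphi.
Let siG := semi_inner_grad openO.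
Let siA := semi_inner_ip_grad openO.
Let siL := semi_inner_ip Omega.
Let siLv := semi_inner_ipv Omega.

(** Galerkin orthogonality is exact here, so Cea's lemma applies with [c = 0]. *)
Lemma semi1_w_error chi : V chi -> semi1 (w - wh) <= 2 * semi1 (w - chi).
Proof.
move=> Vchi; have [Vwh _ _ _ [Ew _ _ _]] := sol; have [Ew' _ _ _] := eqs.
have hwh1 := VH1 Vwh; have hd := si_sub siG hw1 hwh1.
have res s : V s -> `|ipv (grad (w - wh)) (grad s)| <= 0 * semi1 s.
  move=> Vs; have hs := VH1 Vs.
  rewrite -(curl_curlE Omega (w - wh) s) (ipv_curlB openO hw1 hwh1 (L2v_curl hs)).
  by rewrite (Ew _ Vs) (Ew' _ Vs) subrr normr0 mul0r.
rewrite -[leRHS]addr0.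
exact: (cea siG VH1 Vsub hw1 Vwh Vchi (lexx 0) res).
Qed.

(** Subtracting the discrete momentum equation from the continuous one leaves the
residual [(curl (w - wh), s)]; Poincare for [s] makes it a bounded functional for
the energy seminorm. *)
Lemma stokes_error psi q : X psi -> P q ->
  let a := semi1v (phi - psi) + 2 * norm0 (p - q) + K * semi1 (w - wh) in
  semi1v (phih - psi) <= (1 + 2 * 2 * beta) * a /\
  norm0 (ph - q) <= beta * (2 + 2 * 2 * beta) * a.
Proof.
move=> Xpsi Pq; have [Vwh Xphih Pph _ [_ Ephi Ediv _]] := sol.
have [_ Ephi' Ediv' _] := eqs.
have hwh1 := VH1 Vwh; have hd := si_sub siG hw1 hwh1.
have hphih1 := XH1 Xphih.
have dual q' c : P q' -> 0 <= c ->
    (forall s, X s -> `|ip (div s) q'| <= c * semi1v s) -> norm0 q' <= beta * c.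
  exact: inf_sup_dual.
have r0 : 0 <= K * semi1 (w - wh) by rewrite mulr_ge0 // sqrtr_ge0.
have divBr s p' q' : H1v Omega s -> L2 p' -> L2 q' ->
    ip (div s) (p' - q') = ip (div s) p' - ip (div s) q'.
  by move=> hs hp' hq'; exact: (si_Br siL hp' hq' (L2_div hs)).
have res s : X s -> `|ip_grad (phi - phih) s + ip (div s) (p - ph)| <=
    K * semi1 (w - wh) * semi1v s.
  move=> Xs; have hs := XH1 Xs.
  have -> : ip_grad (phi - phih) s + ip (div s) (p - ph) = ipv s (curl (w - wh)).
    have e1 := si_Bl siA hphi1 hphih1 hs.
    have e2 := divBr _ _ _ hs hp (PL Pph).
    have e3 := ipv_curlB openO hw1 hwh1 (H1v_L2v hs).
    have e4 := si_sym siLv (H1v_L2v hs) (L2v_curl hd).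
    rewrite e1 e2 e4 e3 -(Ephi _ Xs) -(Ephi' _ Xs).
    by rewrite addrACA -opprD.
  apply: le_trans (ipv_curl_le hd (H1v_L2v hs)) _.
  rewrite mulrAC; apply: ler_wpM2r; first exact: sqrtr_ge0.
  exact: poincv (XH Xs).
have cons t : P t -> ip (div (phi - phih)) t = 0.
  move=> Pt; rewrite (ip_divB openO hphi1 hphih1 (PL Pt)).
  by rewrite (Ediv _ Pt) (Ediv' _ Pt) subrr.
exact: (saddle_estimate siA siL XH1 PL Xsub Psub
  (fun F G q' => @ip_divB _ _ openO F G q') divBr (ler0n _ 2) (ltW beta0)
  (fun F q' => @ip_div_le _ _ openO F q') dual
  hphi1 Xphih Xpsi hp Pph Pq r0 res cons).
Qed.

Let curl_residual s : V s ->
  ipv (curl u) (curl s) - ipv (curl uh) (curl s) = ipv (phi - phih) (curl s).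
Proof.
move=> Vs; have [_ Xphih _ _ [_ _ _ Eu]] := sol; have [_ _ _ Eu'] := eqs.
rewrite (Eu _ Vs) (Eu' _ Vs); apply: esym.
exact: (si_Bl siLv (H1v_L2v hphi1) (H1v_L2v (XH1 Xphih)) (L2v_curl (VH1 Vs))).
Qed.

Let hphid : L2v Omega (phi - phih).
Proof.
have [_ Xphih _ _ _] := sol.
exact: (si_sub siLv (H1v_L2v hphi1) (H1v_L2v (XH1 Xphih))).
Qed.

Lemma semi1_u_error v : V v ->
  semi1 (u - uh) <= 2 * semi1 (u - v) + norm0v (phi - phih).
Proof.
move=> Vv; have [_ _ _ Vuh _] := sol; have huh1 := VH1 Vuh.
have hd := si_sub siG hu1 huh1.
have res s : V s -> `|ipv (grad (u - uh)) (grad s)| <= norm0v (phi - phih) * semi1 s.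
  move=> Vs; have hs := VH1 Vs.
  rewrite -(curl_curlE Omega (u - uh) s) (ipv_curlB openO hu1 huh1 (L2v_curl hs)).
  by rewrite (curl_residual Vs); exact: (ipv_curl_le hs hphid).
exact: (cea siG VH1 Vsub hu1 Vuh Vv (sqrtr_ge0 _) res).
Qed.

(** [Pu] solves the discrete equation of [uh] with data [phi] instead of [phih]. *)
Lemma semi1_grad_proj_error Pu : is_grad_proj Omega V u Pu ->
  semi1 (Pu - uh) <= norm0v (phi - phih).
Proof.
move=> [VPu EPu]; have [_ _ _ Vuh _] := sol; have huh1 := VH1 Vuh.
have Vz := Vsub VPu Vuh; have hz := VH1 Vz; have hPu := VH1 VPu.
apply: (si_norm_le siG hz); last exact: sqrtr_ge0.
apply: le_trans (ler_norm _) _.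
have -> : ipv (grad (Pu - uh)) (grad (Pu - uh)) = ipv (phi - phih) (curl (Pu - uh)).
  rewrite (si_Bl siG hPu huh1 hz) (EPu _ Vz).
  by rewrite -(curl_curlE Omega u (Pu - uh)) -(curl_curlE Omega uh (Pu - uh))
    (curl_residual Vz).
exact: (ipv_curl_le hz hphid).
Qed.

(** The factor [2 * (1 + K)] bounds the data of [stokes_error] by the three best
approximation errors; the other factors come from [saddle_estimate] with
continuity constant [2] for the divergence form. *)
Definition stokes_const : R :=
  (1 + K) * (1 + (1 + 4 * beta) * (2 * (1 + K))).
Definition pressure_const : R :=
  1 + beta * (2 + 4 * beta) * (2 * (1 + K)).

(** The arithmetic that combines [stokes_error] with the error of [w]: [W], [F],
[Q] are the approximation errors of [w], [phi], [p], and the variables beginning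
with [s] and [n] are seminorms and norms of errors. *)
Let final_arith (W F Q sw sfh sf nw nqh a nphi np : R) :
  0 <= W -> 0 <= F -> 0 <= Q ->
  sw <= 2 * W -> sf <= F -> a = sf + 2 * Q + K * sw ->
  sfh <= (1 + 2 * 2 * beta) * a -> nqh <= beta * (2 + 2 * 2 * beta) * a ->
  nw <= (1 + K) * sw -> nphi <= (1 + K) * (sf + sfh) -> np <= Q + nqh ->
  [/\ nw <= 2 * (1 + K) * (W + F + Q), nphi <= stokes_const * (W + F + Q) &
      np <= pressure_const * (W + F + Q)].
Proof.
move=> W0 F0 Q0 hsw hsf aE hsfh hnqh hnw hnphi hnp.
have b0 := ltW beta0; have K1 : 0 <= 1 + K by rewrite addr_ge0.
have T0 : 0 <= W + F + Q by rewrite !addr_ge0.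
have KW : K * sw <= K * (2 * W) by rewrite ler_wpM2l.
have KW0 : 0 <= K * (F + Q) by rewrite mulr_ge0 // addr_ge0.
have aT : a <= 2 * (1 + K) * (W + F + Q) by rewrite aE; lra.
have h1 : (1 + K) * sw <= (1 + K) * (2 * W) by rewrite ler_wpM2l.
have h2 : 0 <= (1 + K) * (F + Q) by rewrite mulr_ge0 // addr_ge0.
have s4 : 0 <= 1 + 2 * 2 * beta by rewrite addr_ge0 // !mulr_ge0.
have p4 : 0 <= beta * (2 + 2 * 2 * beta) by rewrite mulr_ge0 // addr_ge0 // !mulr_ge0.
have h3 := ler_wpM2l s4 aT; have h4 := ler_wpM2l p4 aT.
have h5 : (1 + K) * (sf + sfh) <=
    (1 + K) * (W + F + Q + (1 + 2 * 2 * beta) * (2 * (1 + K) * (W + F + Q))).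
  by rewrite ler_wpM2l //; lra.
rewrite /stokes_const /pressure_const; split; lra.
Qed.

Lemma discrete_errors chi psi q : V chi -> X psi -> P q ->
  let T := norm1 (w - chi) + norm1v (phi - psi) + norm0 (p - q) in
  [/\ norm1 (w - wh) <= 2 * (1 + K) * T,
      norm1v (phi - phih) <= stokes_const * T &
      norm0 (p - ph) <= pressure_const * T].
Proof.
move=> Vchi Xpsi Pq; have [Vwh Xphih Pph _ _] := sol.
have hchi := VH1 Vchi; have hpsi := XH1 Xpsi; have hphih := XH1 Xphih.
have [e1 e2] := stokes_error Xpsi Pq.
have h1 : semi1 (w - wh) <= 2 * norm1 (w - chi).
  apply: le_trans (semi1_w_error Vchi) _; rewrite ler_pM2l //.
  exact: semi1_le_norm1.
have h2 := norm1_le_semi1 (H10_sub openO hw (VH Vwh)).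
have t1 : semi1v (phi - phih) <= semi1v (phi - psi) + semi1v (psi - phih) :=
  si_triangleB siA hphi1 hpsi hphih.
have t2 : semi1v (psi - phih) = semi1v (phih - psi) := si_normBC siA hpsi hphih.
have h3 : norm1v (phi - phih) <= (1 + K) * (semi1v (phi - psi) + semi1v (phih - psi)).
  apply: le_trans (norm1v_le_semi1v (H10v_sub openO hphi (XH Xphih))) _.
  by apply: ler_wpM2l; [rewrite addr_ge0|rewrite -t2].
have t3 : norm0 (p - ph) <= norm0 (p - q) + norm0 (q - ph) :=
  si_triangleB siL hp (PL Pq) (PL Pph).
have t4 : norm0 (q - ph) = norm0 (ph - q) := si_normBC siL (PL Pq) (PL Pph).
rewrite t4 in t3.
have W0 : 0 <= norm1 (w - chi) := sqrtr_ge0 _.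
have F0 : 0 <= norm1v (phi - psi) := sqrtr_ge0 _.
have Q0 : 0 <= norm0 (p - q) := sqrtr_ge0 _.
exact: (final_arith W0 F0 Q0 h1
  (semi1v_le_norm1v Omega (phi - psi)) erefl e1 e2 h2 h3 t3).
Qed.

Lemma norm1_u_error v : V v ->
  norm1 (u - uh) <= (1 + K) * (2 * norm1 (u - v) + norm1v (phi - phih)).
Proof.
move=> Vv; have [_ _ _ Vuh _] := sol.
apply: le_trans (norm1_le_semi1 (H10_sub openO hu (VH Vuh))) _.
apply: ler_wpM2l; first by rewrite addr_ge0.
apply: le_trans (semi1_u_error Vv) _; apply: lerD.
  by rewrite ler_pM2l //; exact: semi1_le_norm1.
exact: norm0v_le_norm1v.
Qed.

End DiscreteErrors.

Lemma total_arith (R : realType) (K cphi cp W F Q U nw nphi np nu : R) :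
  0 < 1 + K -> 0 < cphi -> 0 < cp -> 0 <= W -> 0 <= F -> 0 <= Q -> 0 <= U ->
  nw <= 2 * (1 + K) * (W + F + Q) -> nphi <= cphi * (W + F + Q) ->
  np <= cp * (W + F + Q) -> nu <= (1 + K) * (2 * U + nphi) ->
  nw + nphi + np + nu <=
  (2 * (1 + K) + cphi + cp + (1 + K) * cphi) * (W + F + Q + U).
Proof.
move=> K1 c0 p0 W0 F0 Q0 U0 h1 h2 h3 h4.
have h5 := ler_wpM2l (ltW K1) h2.
have u1 : 0 <= cphi * U by rewrite mulr_ge0 // ltW.
have u2 : 0 <= cp * U by rewrite mulr_ge0 // ltW.
have u3 : 0 <= (1 + K) * (cphi * U) by rewrite mulr_ge0 // ltW.
by lra.
Qed.

Theorem theorem4p5 (R : realType) (Omega : set (R * R)) (delta : R)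
    (Omega_dom : bounded_lipschitz_domain Omega)
    (Omega_sc : simply_connected Omega)
    (Omega_bd : connected (boundary Omega))
    (delta_gt : 2^-1 < delta) (delta_le : delta <= 1)
    (I : Type) (h : I -> R)
    (V : I -> set (R * R -> R)) (X : I -> set (R * R -> R * R))
    (P : I -> set (R * R -> R))
    (h_gt0 : forall i, 0 < h i)
    (V_fin : forall i, finite_dim (V i))
    (X_fin : forall i, finite_dim (X i))
    (P_fin : forall i, finite_dim (P i))
    (V_conf : forall i, V i `<=` H10 Omega)
    (X_conf : forall i, X i `<=` H10v Omega)
    (P_conf : forall i, P i `<=` L20 Omega)
    (VXP_cons : forall i, consistent Omega (V i) (X i) (P i))
    (XP_infsup : exists2 C : R, 0 < C & forall i, inf_sup Omega C (X i) (P i)) :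
  (exists2 C : R, 0 < C &
    forall (f w : R * R -> R) (phi : R * R -> R * R) (p u : R * R -> R),
    L2 Omega f -> continuous_solution Omega f w phi p u ->
    forall (i : I) (wh : R * R -> R) (phih : R * R -> R * R)
      (ph uh : R * R -> R),
    decoupled_solution Omega (V i) (X i) (P i) f wh phih ph uh ->
    norm1 Omega (w - wh) + norm1v Omega (phi - phih) + norm0 Omega (p - ph)
      + norm1 Omega (u - uh)
    <= C * (dist1 Omega (V i) w + dist1v Omega (X i) phi + dist0 Omega (P i) p
            + dist1 Omega (V i) u))
  /\
  (forall C1 : R, 0 < C1 -> exists2 C2 : R, 0 < C2 &
    forall (f w : R * R -> R) (phi : R * R -> R * R) (p u : R * R -> R),
    L2 Omega f -> continuous_solution Omega f w phi p u ->
    forall (wh : I -> R * R -> R) (phih : I -> R * R -> R * R)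
      (ph uh : I -> R * R -> R),
    (forall i, decoupled_solution Omega (V i) (X i) (P i) f
                 (wh i) (phih i) (ph i) (uh i)) ->
    (forall i, norm0v Omega (phi - phih i)
       <= C1 * (h i `^ delta
                * (norm1v Omega (phi - phih i) + dist0 Omega (P i) p))) ->
    forall (i : I) (Pu : R * R -> R), is_grad_proj Omega (V i) u Pu ->
    semi1 Omega (Pu - uh i)
    <= C2 * (h i `^ delta
             * (dist1 Omega (V i) w + dist1v Omega (X i) phi
                + dist0 Omega (P i) p))).
Proof.
have [_ openO _ bndO _] := Omega_dom.
have [M M0 OM] := bounded_abscissa bndO.
have [beta beta0 infsup] := XP_infsup.
pose K := 2 * M; have K0 : 0 <= K by rewrite mulr_ge0.
have poinc v : H10 Omega v -> norm0 Omega v <= K * semi1 Omega v.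
  exact: poincare.
have poincv F : H10v Omega F -> norm0v Omega F <= K * semi1v Omega F.
  exact: poincarev.
have Vsub i := finite_dim_sub (V_fin i).
have Xsub i := finite_dim_sub (X_fin i).
have Psub i := finite_dim_sub (P_fin i).
have PL i : P i `<=` L2 Omega by move=> q /P_conf[].
have K1 : 0 < 1 + K by rewrite ltr_wpDr.
pose cphi := stokes_const K beta; pose cp := pressure_const K beta.
have b0 := ltW beta0.
have cphi1 : 0 < cphi.
  have : 0 <= (1 + 4 * beta) * (2 * (1 + K)).
    by rewrite mulr_ge0 ?addr_ge0 ?mulr_ge0 // ltW.
  by move=> ?; rewrite /cphi /stokes_const mulr_gt0 // ltr_wpDr.
have cp0 : 0 < cp.
  rewrite /cp /pressure_const ltr_wpDr // !mulr_ge0 ?addr_ge0 ?mulr_ge0 // ltW //.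
split.
- pose C := 2 * (1 + K) + cphi + cp + (1 + K) * cphi.
  have k1 : 0 < 2 * (1 + K) by rewrite mulr_gt0.
  have k2 : 0 < (1 + K) * cphi by rewrite mulr_gt0.
  have C0 : 0 < C := addr_gt0 (addr_gt0 (addr_gt0 k1 cphi1) cp0) k2.
  exists C => // f w phi p u hf hc i wh phih ph uh hd.
  have [hw hphi hp hu _] := hc; have [Vwh Xphih Pph Vuh _] := hd.
  set l := (X in X <= _).
  rewrite addrC; apply: le_inf_image => //; first by exists uh.
  move=> v Vv; rewrite addrC.
  apply: le_inf_image3 => //; [by exists wh|by exists phih|by exists ph|].
  move=> chi psi q Vchi Xpsi Pq.
  have [e1 e2 e3] := discrete_errors openO K0 poinc poincv (V_conf i) (X_conf i)
    (PL i) (Vsub i) (Xsub i) (Psub i) beta0 (infsup i) hw hphi (proj1 hp)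
    (VXP_cons i _ _ _ _ _ hf hc) hd Vchi Xpsi Pq.
  have e4 := norm1_u_error openO K0 poinc (V_conf i) (X_conf i)
    (Vsub i) hphi hu (VXP_cons i _ _ _ _ _ hf hc) hd Vv.
  have W0 : 0 <= norm1 Omega (w - chi) := sqrtr_ge0 _.
  have F0 : 0 <= norm1v Omega (phi - psi) := sqrtr_ge0 _.
  have Q0 : 0 <= norm0 Omega (p - q) := sqrtr_ge0 _.
  have U0 : 0 <= norm1 Omega (u - v) := sqrtr_ge0 _.
  exact: (total_arith K1 cphi1 cp0 W0 F0 Q0 U0 e1 e2 e3 e4).
- move=> C1 C10; exists (C1 * (cphi + 1)); first by rewrite mulr_gt0 // addr_gt0.
  move=> f w phi p u hf hc wh phih ph uh hd hyp i Pu hPu.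
  have [hw hphi hp _ _] := hc; have [Vwh Xphih Pph _ _] := hd i.
  apply: le_trans (semi1_grad_proj_error openO (V_conf i) (X_conf i)
    (Vsub i) hphi (VXP_cons i _ _ _ _ _ hf hc) (hd i) hPu) _.
  apply: le_trans (hyp i) _; rewrite -mulrA ler_pM2l // mulrCA.
  apply: ler_wpM2l; first exact: powR_ge0.
  have e2 : norm1v Omega (phi - phih i) <=
      cphi * (dist1 Omega (V i) w + dist1v Omega (X i) phi + dist0 Omega (P i) p).
    rewrite -[X in _ * X]addr0.
    apply: le_inf_image3 => //; [by exists (wh i)|by exists (phih i)|by exists (ph i)|].
    move=> chi psi q Vchi Xpsi Pq; rewrite addr0.
    by have [_ + _] := discrete_errors openO K0 poinc poincv (V_conf i) (X_conf i)
      (PL i) (Vsub i) (Xsub i) (Psub i) beta0 (infsup i) hw hphi (proj1 hp)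
      (VXP_cons i _ _ _ _ _ hf hc) (hd i) Vchi Xpsi Pq.
  rewrite mulrDl mul1r; apply: lerD => //; rewrite lerDr addr_ge0 //.
    by apply: inf_image_ge0; [exists (wh i)|move=> s; exact: sqrtr_ge0].
  by apply: inf_image_ge0; [exists (phih i)|move=> s; exact: sqrtr_ge0].
Qed.
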